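(* Let $n\ge2$ and let $(Z,\tilde m,\tilde s,\tilde E)$ be the quotient groupoid $G_B/B_0$ coming from the Iwasawa decomposition of $SO_0(1,n+1)$, identified as a set with $TS^n\times\mathbb{R}_+$. It has the following differential (Lie) groupoid structure: (a) $Z=TS^n\times\mathbb{R}_+$, $\tilde E=S^n\times\{1\}\simeq S^n$ (with $S^n$ embedded in $TS^n$ as the zero section). (b) Let $p_0:=\begin{pmatrix}0\\1\end{pmatrix}\in S^n$. The left and right groupoid fibers over $p_0$ coincide and, denoting them by $F_0$, we have $F_0=T_{p_0}S^n\times\mathbb{R}_+$; thus there is a decomposition $Z=F_0\sqcup Z_1$, where $F_0$ is a group and $Z$ is the closure of the open subgroupoid $Z_1=T(S^n\setminus\{p_0\})\times\mathbb{R}_+$. (c) The group operations in $F_0$ are $(s_1,\mu_1)(s_2,\mu_2)=(s_1s_2,\ s_2\mu_1+\mu_2)$, $(s,\mu)^{-1}=\left(\frac1s,-\frac{\mu}{s}\right)$, where $(s,\mu)$ stands for $\left(p_0,\begin{pmatrix}\mu\\0\end{pmatrix},s\right)\in F_0$; in other words $F_0\simeq C$. (d) Let $x:=\frac{u}{1-\alpha}\in\mathbb{R}^n$ (for $p=\begin{pmatrix}u\\\alpha\end{pmatrix}$) be the stereographic projection $S^n\setminus\{p_0\}\to\mathbb{R}^n$ and let $(x,\dot x)$ stand for the corresponding tangent coordinates $T\mathbb{R}^n=\mathbb{R}^n\times\mathbb{R}^n\to T(S^n\setminus\{p_0\})$. The groupoid structure of $Z_1$ is given by $$\tilde s(x,\dot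 x,s)=\left(sx-\frac{2}{1+|x|^2}\dot x,\ -\frac{1+\left|sx-\frac{2\dot x}{1+|x|^2}\right|^2}{1+|x|^2}\,\frac{\dot x}{s},\ \frac1s\right),$$ $$\tilde m=\left\{\left(x_1,\ s_2\dot x_1+\dot x_2\frac{1+|x_1|^2}{1+|x_2|^2},\ s_1s_2;\ x_1,\dot x_1,s_1,\ x_2,\dot x_2,s_2\right):\ x_2=s_1x_1-\frac{2\dot x_1}{1+|x_1|^2}\right\};$$ these formulae imply that $\tilde e_L(x,\dot x,s)=(x,0,1)$ and $\tilde e_R(x,\dot x,s)=\left(sx-\frac{2\dot x}{1+|x|^2},0,1\right)$. (e) $Z_1$ is transitive and the isotropy group at $(x_0,0,1)$ is equal to $\left\{\left(x_0,\ x_0\frac{(s-1)(1+|x_0|^2)}{2},\ s\right): s\in\mathbb{R}_+\right\}$. (f) The closed submanifold $\tilde S:=TS^n\times\{1\}\simeq TS^n$ is a wide subgroupoid of $Z$.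
   Context: $\mathbb{R}_+=(0,\infty)$. Let $G=SO_0(1,n+1)$. The subgroup $B\subset G$ is $SO(n+1)$ embedded by $g\mapsto\begin{pmatrix}1&0\\0&g\end{pmatrix}$; its elements are written $(\Lambda,u,w,\alpha):=\begin{pmatrix}\Lambda&u\\ w^t&\alpha\end{pmatrix}$ with $\Lambda\in M_n(\mathbb{R})$, $u,w\in\mathbb{R}^n$, $\alpha\in[-1,1]$. The subgroup $C\subset G$ consists of the matrices $$(s,y):=\begin{pmatrix}\frac{s^2+1+|y|^2}{2s}&-\frac1sy^t&\frac{s^2-1+|y|^2}{2s}\\-y&I&-y\\\frac{s^2-1-|y|^2}{2s}&\frac1sy^t&\frac{s^2+1-|y|^2}{2s}\end{pmatrix},\quad s\in\mathbb{R}_+,\ y\in\mathbb{R}^n,$$ with multiplication $(s_1,y_1)(s_2,y_2)=(s_1s_2,s_2y_1+y_2)$. By the Iwasawa decomposition $G=BC=CB$, $B\cap C=\{e\}$, every $g\in G$ is uniquely $g=b_L(g)c_R(g)=c_L(g)b_R(g)$ with $b_L,b_R\in B$, $c_L,c_R\in C$. $(\Lambda,u,w,\alpha;s,y)$ denotes the product $(\Lambda,u,w,\alpha)(s,y)\in G$. The groupoid $G_B\rightrightarrows B$ is the set $G$ with units $B$, left (target) projection $b_L$, right (source) projection $b_R$, inverse $s_B(g)=c_L(g)^{-1}b_L(g)$, and product of $g_1,g_2$ defined when $b_R(g_1)=b_L(g_2)$ and equal to $g_1c_R(g_2)$; $m_B$ is its multiplication relation. $B_0:=N(C)\cap B=\{(\Lambda,0,0,1)\}\simeq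 SO(n)$ acts on $G_B$ by right translations $\gamma\mapsto\gamma b_0$, which are groupoid automorphisms. $Z:=G_B/B_0$ carries the unique groupoid structure for which the transpose of the canonical projection $\pi_Z:G\to Z$ is a morphism of groupoids (in the sense of relations): $\tilde E=\pi_Z(B)$, and the graphs of inverse and multiplication are $(\pi_Z\times\pi_Z)(\mathrm{Gr}(s_B))$ and $(\pi_Z\times\pi_Z\times\pi_Z)(\mathrm{Gr}(m_B))$; graphs of multiplications are written with the result first, (result; first factor, second factor). $Z$ is identified with $TS^n\times\mathbb{R}_+$, where $TS^n=\{(p,v)\in\mathbb{R}^{n+1}\times\mathbb{R}^{n+1}:|p|=1,\ p\cdot v=0\}$, via $$\pi_Z(\Lambda,u,w,\alpha;s,y)=\left(p=\begin{pmatrix}u\\\alpha\end{pmatrix},\ v=\begin{pmatrix}\Lambda y\\ w^ty\end{pmatrix},\ s\right).$$ Left and right fibers over a unit are the preimages of that unit under the left projection $\tilde e_L$ and the right projection $\tilde e_R$. A differential groupoid is a groupoid on a manifold with units a submanifold, projections submersions, inverse and multiplication smooth. A subgroupoid is wide if it contains all units. In the coordinates of (d), $(x,\dot x,s)$ represents the point $(p(x),v,s)$ with $p(x)=\left(\frac{2x}{1+|x|^2},\frac{|x|^2-1}{|x|^2+1}\right)$ and $v=\frac{d}{dt}\big|_{t=0}p(x+t\dot x)$. *)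

(* Defs.v *)
From HB Require Import structures.
From mathcomp Require Import all_boot all_order all_algebra.
From mathcomp Require Import all_classical all_reals all_analysis.
Import numFieldNormedType.Exports.

Set Implicit Arguments.
Unset Strict Implicit.
Unset Printing Implicit Defensive.

Import Order.TTheory GRing.Theory Num.Theory.

Local Open Scope classical_set_scope.
Local Open Scope ring_scope.

(* Manifolds are embedded submanifolds of a finite-dimensional normed space,
   and maps between them are maps of the ambient spaces; the values outside
   the manifold are irrelevant. *)
Section Smooth.
Variables (R : realType).

(* Meant for open U and finite-dimensional V, where this is the usual C^k. *)
Fixpoint Ck (V W : normedModType R) (k : nat) (U : set V) (f : V -> W) : Prop :=
  if k is k'.+1 then
    (forall x, U x -> differentiable f x) /\ (forall v, Ck k' U ('D_v f))
  else forall x, U x -> {for x, continuous f}.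

Definition smooth_on (V W : normedModType R) (U : set V) (f : V -> W) : Prop :=
  forall k, Ck k U f.

(* Smoothness on an arbitrary subset: locally the restriction of a smooth map
   defined on an open subset of the ambient space. *)
Definition smooth_map (V W : normedModType R) (X : set V) (f : V -> W) : Prop :=
  forall x, X x -> exists (U : set V) (F : V -> W),
    [/\ open U, U x, smooth_on U F & forall y, (X `&` U) y -> f y = F y].

Definition diffeo (V W : normedModType R) (X : set V) (Y : set W)
    (f : V -> W) : Prop :=
  exists g : W -> V,
    [/\ set_fun X Y f, set_fun Y X g,
        {in X, cancel f g} /\ {in Y, cancel g f},
        smooth_map X f & smooth_map Y g].

Definition submanifold (V : normedModType R) (k : nat) (X : set V) : Prop :=
  forall x, X x -> exists (U : set V) (O : set 'cV[R]_k) (phi : 'cV[R]_k -> V),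
    [/\ open U, U x, open O & diffeo O (X `&` U) phi].

Definition smooth_curve_at (V : normedModType R) (X : set V) (x : V)
    (c : R -> V) : Prop :=
  c 0 = x /\ exists U : set R,
    [/\ open U, U 0, smooth_on U c & forall t, U t -> X (c t)].

Definition tangent_space (V : normedModType R) (X : set V) (x : V) : set V :=
  [set derive1 c 0 | c in smooth_curve_at X x].

(* The tangent map of f sends c'(0) to (f o c)'(0). *)
Definition submersion (V W : normedModType R) (X : set V) (Y : set W)
    (f : V -> W) : Prop :=
  [/\ set_fun X Y f, smooth_map X f &
      forall x, X x ->
        [set derive1 (f \o c) 0 | c in smooth_curve_at X x]
          = tangent_space Y (f x)].

Definition open_in (V : topologicalType) (X A : set V) : Prop :=
  exists2 U, open U & A = X `&` U.

Definition closed_in (V : topologicalType) (X A : set V) : Prop :=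
  exists2 K, closed K & A = X `&` K.

End Smooth.

Section Groupoids.
Variables (T : Type).
Implicit Types (X E S : set T) (l r s : T -> T) (m : T -> T -> T).

Definition composable X l r : set (T * T) :=
  [set xy | [/\ X xy.1, X xy.2 & r xy.1 = l xy.2]].

Record is_groupoid X E l r s m : Prop := IsGroupoid {
  units_sub : E `<=` X ;
  lproj_unit : forall x, X x -> E (l x) ;
  rproj_unit : forall x, X x -> E (r x) ;
  lproj_id : forall e, E e -> l e = e ;
  rproj_id : forall e, E e -> r e = e ;
  inv_closed : forall x, X x -> X (s x) ;
  mul_closed : forall x y, composable X l r (x, y) -> X (m x y) ;
  lproj_mul : forall x y, composable X l r (x, y) -> l (m x y) = l x ;
  rproj_mul : forall x y, composable X l r (x, y) -> r (m x y) = r y ;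
  mul_assoc : forall x y z, composable X l r (x, y) ->
    composable X l r (y, z) -> m (m x y) z = m x (m y z) ;
  mul_lunit : forall x, X x -> m (l x) x = x ;
  mul_runit : forall x, X x -> m x (r x) = x ;
  lproj_inv : forall x, X x -> l (s x) = r x ;
  rproj_inv : forall x, X x -> r (s x) = l x ;
  mul_inv_r : forall x, X x -> m x (s x) = l x ;
  mul_inv_l : forall x, X x -> m (s x) x = r x }.

Definition subgroupoid X l r s m S : Prop :=
  [/\ S `<=` X,
      forall x, S x -> [/\ S (l x), S (r x) & S (s x)] &
      forall x y, S x -> S y -> r x = l y -> S (m x y)].

Definition wide_subgroupoid X E l r s m S : Prop :=
  subgroupoid X l r s m S /\ E `<=` S.

Definition transitive_groupoid X E l r : Prop :=
  forall e f, E e -> E f -> exists x, [/\ X x, l x = e & r x = f].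

Definition isotropy X l r (e : T) : set T :=
  [set x | [/\ X x, l x = e & r x = e]].

Definition is_group (F : set T) (e : T) (s : T -> T) (m : T -> T -> T) : Prop :=
  [/\ F e,
      forall x, F x -> F (s x),
      forall x y, F x -> F y -> F (m x y),
      forall x y z, F x -> F y -> F z -> m (m x y) z = m x (m y z) &
      forall x, F x -> [/\ m e x = x, m x e = x, m (s x) x = e & m x (s x) = e]].

End Groupoids.

Definition differential_groupoid (R : realType) (V : normedModType R)
    (dX dE : nat) (X E : set V) (l r s : V -> V) (m : V -> V -> V) : Prop :=
  [/\ is_groupoid X E l r s m,
      submanifold dX X /\ submanifold dE E,
      submersion X E l /\ submersion X E r,
      smooth_map X s &
      smooth_map (composable X l r) (fun xy => m xy.1 xy.2)].

(* The norm `|x| of the library on vectors is the sup norm; Euclidean norms are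
   expressed with dot. *)
Definition dot (R : realType) (m : nat) (x y : 'cV[R]_m) : R :=
  (x^T *m y) 0 0.

Notation Zamb R n := ('cV[R]_(n + 1) * 'cV[R]_(n + 1) * R)%type.

Section Iwasawa.
Variables (R : realType) (n : nat).

Notation mat := 'M[R]_(1 + (n + 1)).

Definition lorentz : mat := block_mx 1%:M 0 0 (- 1%:M).

Definition SO1 : set mat :=
  [set g | g^T *m lorentz *m g = lorentz /\ \det g = 1].

Definition G : set mat := connected_component SO1 1%:M.

Definition SO (k : nat) : set 'M[R]_k :=
  [set h | h^T *m h = 1%:M /\ \det h = 1].

Local Arguments SO : clear implicits.

Definition B : set mat := [set block_mx 1%:M 0 0 h | h in SO (n + 1)%N].

Definition Bmx (L : 'M[R]_n) (u w : 'cV[R]_n) (a : R) : mat :=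
  block_mx 1%:M 0 0 (block_mx L u w^T a%:M).

Definition Cmx (s : R) (y : 'cV[R]_n) : mat :=
  block_mx
    ((s ^+ 2 + 1 + dot y y) / (2 * s))%:M
    (row_mx (- (s^-1 *: y^T)) ((s ^+ 2 - 1 + dot y y) / (2 * s))%:M)
    (col_mx (- y) ((s ^+ 2 - 1 - dot y y) / (2 * s))%:M)
    (block_mx 1%:M (- y)
       (s^-1 *: y^T) ((s ^+ 2 + 1 - dot y y) / (2 * s))%:M).

Definition C : set mat := [set c | exists s y, 0 < s /\ c = Cmx s y].

(* The factors of g = bL g *m cR g = cL g *m bR g; the default value 1%:M is
   never used on G, by the Iwasawa decomposition. *)
Definition bL (g : mat) : mat :=
  xget 1%:M [set b | B b /\ exists2 c, C c & g = b *m c].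
Definition cR (g : mat) : mat :=
  xget 1%:M [set c | C c /\ exists2 b, B b & g = b *m c].
Definition cL (g : mat) : mat :=
  xget 1%:M [set c | C c /\ exists2 b, B b & g = c *m b].
Definition bR (g : mat) : mat :=
  xget 1%:M [set b | B b /\ exists2 c, C c & g = c *m b].

Definition sB (g : mat) : mat := invmx (cL g) *m bL g.

(* Graphs are written with the result first. *)
Definition graph_sB : set (mat * mat) := [set (sB g, g) | g in G].

Definition graph_mB : set (mat * mat * mat) :=
  [set t | exists g1 g2, [/\ G g1, G g2, bR g1 = bL g2 &
     t = (g1 *m cR g2, g1, g2)]].

Definition normC : set mat :=
  [set g | G g /\ [set g *m c *m invmx g | c in C] = C].

Definition B0 : set mat := normC `&` B.

Definition sphere : set 'cV[R]_(n + 1) := [set p | dot p p = 1].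

Definition TS : set ('cV[R]_(n + 1) * 'cV[R]_(n + 1)) :=
  [set pv | sphere pv.1 /\ dot pv.1 pv.2 = 0].

Definition Zset : set (Zamb R n) := TS `*` [set s | 0 < s].

Definition piZ (g : mat) : Zamb R n :=
  xget (0, 0, 1) [set z | exists (L : 'M[R]_n) (u w : 'cV[R]_n) (a s : R)
      (y : 'cV[R]_n),
    [/\ B (Bmx L u w a), 0 < s, g = Bmx L u w a *m Cmx s y &
        z = (col_mx u a%:M, col_mx (L *m y) (w^T *m y), s)]].

(* The groupoid structure of Z, as relations: unit set and graphs. *)
Definition Etilde : set (Zamb R n) := piZ @` B.

Definition graph_stilde : set (Zamb R n * Zamb R n) :=
  [set (piZ t.1, piZ t.2) | t in graph_sB].

Definition graph_mtilde : set (Zamb R n * Zamb R n * Zamb R n) :=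
  [set (piZ t.1.1, piZ t.1.2, piZ t.2) | t in graph_mB].

(* The maps determined by these relations: eL z is the unit e with e z = z,
   eR z the unit e with z e = z. *)
Definition eL (z : Zamb R n) : Zamb R n :=
  xget z [set e | Etilde e /\ graph_mtilde (z, e, z)].
Definition eR (z : Zamb R n) : Zamb R n :=
  xget z [set e | Etilde e /\ graph_mtilde (z, z, e)].
Definition stilde (z : Zamb R n) : Zamb R n :=
  xget z [set z' | graph_stilde (z', z)].
Definition mtilde (z1 z2 : Zamb R n) : Zamb R n :=
  xget z1 [set z | graph_mtilde (z, z1, z2)].

Definition p0 : 'cV[R]_(n + 1) := col_mx 0 1%:M.

Definition F0 : set (Zamb R n) :=
  [set z | [/\ z.1.1 = p0, dot p0 z.1.2 = 0 & 0 < z.2]].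

Definition F0coord (s : R) (mu : 'cV[R]_n) : Zamb R n := (p0, col_mx mu 0, s).

Definition Z1 : set (Zamb R n) := [set z | Zset z /\ z.1.1 <> p0].

Definition Stilde : set (Zamb R n) := [set z | TS z.1 /\ z.2 = 1].

Definition stereo (p : 'cV[R]_(n + 1)) : 'cV[R]_n :=
  (1 - dsubmx p 0 0)^-1 *: usubmx p.

Definition stereo_inv (x : 'cV[R]_n) : 'cV[R]_(n + 1) :=
  col_mx ((2 / (1 + dot x x)) *: x) ((dot x x - 1) / (dot x x + 1))%:M.

(* The point of Z1 with coordinates (x, xd, s). *)
Definition kappa (x xd : 'cV[R]_n) (s : R) : Zamb R n :=
  (stereo_inv x, derive1 (fun t : R => stereo_inv (x + t *: xd)) 0, s).

End Iwasawa.

Arguments SO {R} k.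
Arguments G {R n}.
Arguments B {R n}.
Arguments C {R n}.
Arguments B0 {R n}.
Arguments sphere {R n}.
Arguments Zset {R n}.
Arguments Etilde {R n}.
Arguments graph_stilde {R n}.
Arguments graph_mtilde {R n}.
Arguments p0 {R n}.
Arguments F0 {R n}.
Arguments Z1 {R n}.
Arguments Stilde {R n}.

(* Main.v *)
Require Import Defs.
From HB Require Import structures.
From mathcomp Require Import all_boot all_order all_algebra.
From mathcomp Require Import all_classical all_reals all_analysis.
Import numFieldNormedType.Exports.
Import Order.TTheory GRing.Theory Num.Theory.
Local Open Scope classical_set_scope.
Local Open Scope ring_scope.
From mathcomp Require Import ring lra.

(** The rotation subgroup B consists of the matrices [dg h = diag(1, h)], and
conjugating [Cmx s y] by [dg h] gives a matrix that depends only on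
[p = h p0], [v = h (y, 0)] and [s]; it is called [Tmx p v s].  Hence an element
[g = dg h *m Cmx s y] of G, which lies over [z = (p, v, s)] in Z, is also
[Tmx p v s *m dg h].  Let [coc z] be the rotation factor in the Iwasawa
decomposition [Tmx p v s = c *m dg (coc z)].  Then [c_L g = c] depends on [z]
alone and [b_R g = dg (coc z *m h)], so that the quotient relations are the
graphs of

    e_L z = (p, 0, 1),            e_R z = (coc z p, 0, 1),
    z^-1 = (coc z p, - s^-1 coc z v, s^-1),
    z1 z2 = (p1, s2 v1 + (coc z1)^T v2, s1 s2)   when coc z1 p1 = p2.

Everything rests on [coc].  Uniqueness of the Iwasawa factors gives the
cocycle identity [coc (z1 z2) = coc z2 *m coc z1] (lemma [coc_zmul]), from
which the groupoid axioms follow.  The factor in C is read off the first column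
of a matrix, so [coc] is a rational function of [z]; this yields smoothness on
all of Z, including the neighbourhood of the fiber [F0] over the pole.

Away from the pole put [refl x] for the orthogonal reflection along the vector
[(x, -1)].  It sends [p0] to [stereo_inv x], and on the vectors [(y, 0)] it is
the differential of [stereo_inv] at [x] up to the conformal factor
[2 / (1 + |x|^2)].  A point of [Z1] is thus
[Zcoord x y s = (refl x p0, refl x (y, 0), s)], with [y = 2 xd / (1 + |x|^2)] in
the tangent coordinates [(x, xd)].  In stereographic coordinates [Cmx s y] acts
on the sphere, from the right, by [x |-> s x - y], and correspondingly
[dg (refl x) *m Cmx s y *m dg (refl (s x - y))] is again in C (lemma
[refl_Cmx]); therefore [coc (Zcoord x y s) = refl (s x - y) *m refl x].  Over
the pole [Tmx] is [Cmx] and [coc] is the identity.  All the explicit formulas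
for [F0] and [Z1] are obtained by inserting these two values of [coc].

That the identity component G is exactly BC = CB is seen as follows.  On
SO(1, n+1) the upper left entry has square at least 1, so it stays positive on
G, and a Lorentz matrix with positive corner has an Iwasawa decomposition.
Conversely C is path connected, and SO(k) is connected by induction on [k]:
every point of the sphere is the image of the pole under a product
[refl x *m refl x'], which is joined to the identity by moving [x] to [x'].

The two projections are submersions because a curve [q] in the sphere starting
at [p] lifts to the curve [(q, v - (v . q) q, s)]; this serves [e_L], and the
inverse map carries it to [e_R].  Manifold charts of Z come from the
stereographic projections from the two poles. *)

Set Implicit Arguments.
Unset Strict Implicit.
Unset Printing Implicit Defensive.

#[local] Hint Extern 0 (open setT) => exact: openT : core.

(** * Calculus of smooth maps on open sets *)

Section SmoothCalculus.
Context {R : realType}.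
Implicit Types (V W : normedModType R).

Lemma differentiable_near_eq V W (f g : V -> W) (x : V) :
  {near x, f =1 g} -> differentiable f x -> differentiable g x.
Proof.
move=> fg /diff_locallyP[dc df].
have gx : f x = g x by exact: (nbhs_singleton fg).
have dg : g \o shift x = cst (g x) + 'd f x +o_ 0 id.
  apply/eqaddoP => e e0; move/eqaddoP: df => /(_ e e0) df.
  have fg0 : \forall h \near (0 : V), f (h + x) = g (h + x).
    have cx : (fun h : V => h + x) @ (0 : V) --> x.
      by rewrite -[X in _ --> X]add0r; apply: cvgD; [exact: cvg_id|exact: cvg_cst].
    exact: (cx _ fg).
  by near=> h; rewrite !fctE -gx /= -(near fg0 h)//; near: h.
by apply/diff_locallyP; rewrite (diff_unique dc dg).
Unshelve. all: by end_near. Qed.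

Lemma smooth_differentiable V W (U : set V) (f : V -> W) x :
  smooth_on U f -> U x -> differentiable f x.
Proof. by move=> /(_ 1%N)[/(_ x)]. Qed.

Lemma smooth_continuous V W (U : set V) (f : V -> W) x :
  smooth_on U f -> U x -> {for x, continuous f}.
Proof. by move=> sf Ux; apply/differentiable_continuous/(smooth_differentiable sf Ux). Qed.

Lemma smooth_derive V W (U : set V) (f : V -> W) v :
  smooth_on U f -> smooth_on U ('D_v f).
Proof. by move=> sf k; have [_ /(_ v)] := sf k.+1. Qed.

Lemma eq_Ck V W k (U : set V) (f g : V -> W) :
  open U -> (forall x, U x -> f x = g x) -> Ck k U f -> Ck k U g.
Proof.
move=> oU; elim: k f g => [|k IHk] f g fg /=.
  move=> cf x Ux.
  have fgx : {near x, f =1 g}.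
    by apply: filterS (open_nbhs_nbhs (conj oU Ux)) => y Uy; exact: fg.
  have := cf x Ux; rewrite /prop_for /continuous_at (fg _ Ux).
  by apply: cvg_trans; exact: near_eq_cvg.
case=> df Df; split=> [x Ux|v].
  apply: differentiable_near_eq (df x Ux).
  by apply: filterS (open_nbhs_nbhs (conj oU Ux)) => y Uy; exact: fg.
apply: IHk (Df v) => x Ux; apply: near_eq_derive.
by apply: filterS (open_nbhs_nbhs (conj oU Ux)) => y Uy; exact: fg.
Qed.

Lemma eq_smooth V W (U : set V) (f g : V -> W) :
  open U -> (forall x, U x -> f x = g x) -> smooth_on U f -> smooth_on U g.
Proof. by move=> oU fg sf k; exact: eq_Ck fg (sf k). Qed.

(** Differentiability at one more order gives continuity at the previous one;
needed because the Leibniz rule involves the undifferentiated factors. *)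
Lemma Ck_le V W k (U : set V) (f : V -> W) : Ck k.+1 U f -> Ck k U f.
Proof.
elim: k f => [|k IHk] f /=.
  by case=> df _ x Ux; exact/differentiable_continuous/df.
by case=> df Df; split=> // v; apply: IHk; exact: Df.
Qed.

(** A continuous linear map commutes with directional derivatives.  All vector-
and matrix-valued rules are reduced to scalar ones through this lemma. *)
Lemma Ck_linear V W W' k (U : set V) (f : V -> W) (L : W -> W') :
  open U -> linear L -> continuous L -> Ck k U f -> Ck k U (L \o f).
Proof.
move=> oU linL cL; pose H := GRing.isLinear.Build _ _ _ _ L linL.
pose L' : {linear W -> W'} := HB.pack L H.
have dL y : differentiable L y by exact: (@linear_differentiable _ _ _ L').
elim: k f => [|k IHk] f /=.
  by move=> cf x Ux; apply: continuous_comp; [exact: cf|exact: cL].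
case=> df Df; split=> [x Ux|v]; first by apply: differentiable_comp; [exact: df|].
apply: (@eq_Ck _ _ _ _ (L \o 'D_v f)) => // [x Ux|]; last exact: IHk.
have dfx := df _ Ux.
rewrite [RHS]deriveE; last by apply: differentiable_comp.
rewrite diff_comp//= deriveE//.
by rewrite (@diff_lin _ _ _ L').
Qed.

Lemma CkD V W k (U : set V) (f g : V -> W) :
  open U -> Ck k U f -> Ck k U g -> Ck k U (fun x => f x + g x).
Proof.
move=> oU; elim: k f g => [|k IHk] f g /=.
  by move=> cf cg x Ux; apply: cvgD; [exact: cf|exact: cg].
move=> [df Df] [dg Dg]; split=> [x Ux|v].
  by apply: differentiableD; [exact: df|exact: dg].
apply: (@eq_Ck _ _ _ _ (fun x => 'D_v f x + 'D_v g x)) => // [x Ux|]; last exact: IHk.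
by rewrite -deriveD//; apply: diff_derivable; [exact: df|exact: dg].
Qed.

Lemma Ck_scale V W k (U : set V) (f : V -> W) (a : R) :
  open U -> Ck k U f -> Ck k U (fun x => a *: f x).
Proof.
move=> oU; apply: (@Ck_linear _ _ _ _ _ f ( *:%R a)) => //.
  by move=> b u v; rewrite scalerDr !scalerA mulrC.
exact: scaler_continuous.
Qed.

Lemma CkM V k (U : set V) (f g : V -> R) :
  open U -> Ck k U f -> Ck k U g -> Ck k U (fun x => f x * g x).
Proof.
move=> oU; elim: k f g => [|k IHk] f g /=.
  by move=> cf cg x Ux; apply: cvgM; [exact: cf|exact: cg].
move=> Cf Cg; have [df Df] := Cf; have [dg Dg] := Cg; split=> [x Ux|v].
  by apply: differentiableM; [exact: df|exact: dg].
apply: (@eq_Ck _ _ _ _ (fun x => f x * 'D_v g x + g x * 'D_v f x)) => // [x Ux|].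
  by rewrite -deriveM//; apply: diff_derivable; [exact: df|exact: dg].
apply: CkD => //; apply: IHk => //; exact: Ck_le.
Qed.

Lemma CkV V k (U : set V) (f : V -> R) :
  open U -> (forall x, U x -> f x != 0) -> Ck k U f ->
  Ck k U (fun x => (f x)^-1).
Proof.
move=> oU f0; elim: k => [|k IHk] /=.
  by move=> cf x Ux; apply: cvgV; [exact: f0|exact: cf].
move=> Cf; have [df Df] := Cf; split=> [x Ux|v].
  by apply: differentiableV; [exact: df|exact: f0].
have CV := IHk (Ck_le Cf).
apply: (@eq_Ck _ _ _ _ (fun x => (-1) *: ('D_v f x * ((f x)^-1 * (f x)^-1)))) => //.
  move=> x Ux; rewrite deriveV; [|exact: f0|exact/diff_derivable/df].
  by rewrite scaleN1r scaleNr -invfM -expr2 [_ *: _]mulrC.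
by apply: Ck_scale => //; apply: CkM => //; exact: CkM.
Qed.

Lemma smooth_subset V W (U U' : set V) (f : V -> W) :
  U' `<=` U -> smooth_on U f -> smooth_on U' f.
Proof.
move=> UU' sf k; move: f sf; elim: k => [|k IHk] f sf /=.
  by move=> x /UU'; exact: smooth_continuous.
split=> [x /UU'|v]; first exact: smooth_differentiable.
by apply: IHk; exact: smooth_derive.
Qed.

Section Rules.
Context {V : normedModType R} {U : set V} (oU : open U).

Lemma smooth_cst W (w : W) : smooth_on U (fun=> w).
Proof.
move=> k; elim: k w => [|k IHk] w /=; first by move=> x _; exact: cvg_cst.
split=> [x _|v]; first exact: differentiable_cst.
by apply: eq_Ck (IHk 0) => // x _; rewrite derive_cst.
Qed.

Lemma smooth_id : smooth_on U (fun x => x).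
Proof.
case=> [|k] /=; first by move=> x _; exact: cvg_id.
split=> [x _|v]; first exact: ex_diff.
by apply: eq_Ck (@smooth_cst _ v k) => // x _; rewrite derive_id.
Qed.

Lemma smooth_linear W W' (f : V -> W) (L : W -> W') :
  linear L -> continuous L -> smooth_on U f -> smooth_on U (fun x => L (f x)).
Proof. by move=> lL cL sf k; exact: (@Ck_linear _ _ _ k _ f L). Qed.

Lemma smoothD W (f g : V -> W) : smooth_on U f -> smooth_on U g ->
  smooth_on U (fun x => f x + g x).
Proof. by move=> sf sg k; exact: CkD. Qed.

Lemma smoothN W (f : V -> W) : smooth_on U f -> smooth_on U (fun x => - f x).
Proof.
move=> sf k; have := @Ck_scale _ _ k U f (-1) oU (sf k).
by apply: eq_Ck => // x _; rewrite scaleN1r.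
Qed.

Lemma smoothB W (f g : V -> W) : smooth_on U f -> smooth_on U g ->
  smooth_on U (fun x => f x - g x).
Proof. by move=> sf sg; apply: smoothD => //; exact: smoothN. Qed.

Lemma smoothM (f g : V -> R) : smooth_on U f -> smooth_on U g ->
  smooth_on U (fun x => f x * g x).
Proof. by move=> sf sg k; exact: CkM. Qed.

Lemma smoothX (f : V -> R) n : smooth_on U f -> smooth_on U (fun x => f x ^+ n).
Proof.
move=> sf; elim: n => [|n IHn]; first exact: smooth_cst.
have := smoothM sf IHn; apply: eq_smooth => // x _; by rewrite exprS.
Qed.

Lemma smoothV (f : V -> R) : smooth_on U f -> (forall x, U x -> f x != 0) ->
  smooth_on U (fun x => (f x)^-1).
Proof. by move=> sf f0 k; exact: CkV. Qed.

Lemma smooth_sum W I (r : seq I) (F : I -> V -> W) :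
  (forall i, smooth_on U (F i)) -> smooth_on U (fun x => \sum_(i <- r) F i x).
Proof.
move=> sF; elim: r => [|i r IHr].
  by apply: eq_smooth (@smooth_cst W 0) => // x _; rewrite big_nil.
apply: eq_smooth (smoothD (sF i) IHr) => // x _; by rewrite big_cons.
Qed.

Lemma smooth_pair W W' (f : V -> W) (g : V -> W') :
  smooth_on U f -> smooth_on U g -> smooth_on U (fun x => (f x, g x)).
Proof.
move=> sf sg.
have s1 : smooth_on U (fun x => (f x, 0 : W')).
  apply: (@smooth_linear _ _ f (fun w => (w, 0 : W'))) => //.
    by move=> a u v; apply: injective_projections; rewrite //= scaler0 addr0.
  by move=> w; apply: cvg_pair; [exact: cvg_id|exact: cvg_cst].
have s2 : smooth_on U (fun x => (0 : W, g x)).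
  apply: (@smooth_linear _ _ g (fun w => (0 : W, w))) => //.
    by move=> a u v; apply: injective_projections; rewrite //= scaler0 addr0.
  by move=> w; apply: cvg_pair; [exact: cvg_cst|exact: cvg_id].
apply: eq_smooth (smoothD s1 s2) => // x _.
by apply: injective_projections; rewrite /= ?addr0 ?add0r.
Qed.

Lemma smooth_fst W W' (f : V -> W * W') :
  smooth_on U f -> smooth_on U (fun x => (f x).1).
Proof.
by apply: (@smooth_linear _ _ f fst) => // w; exact: cvg_fst.
Qed.

Lemma smooth_snd W W' (f : V -> W * W') :
  smooth_on U f -> smooth_on U (fun x => (f x).2).
Proof.
by apply: (@smooth_linear _ _ f snd) => // w; exact: cvg_snd.
Qed.

Lemma smooth_entry m n (f : V -> 'M[R]_(m, n)) i j :
  smooth_on U f -> smooth_on U (fun x => f x i j).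
Proof.
apply: (@smooth_linear _ _ f (fun A : 'M[R]_(m, n) => A i j)).
  by move=> a u v; rewrite !mxE.
exact: coord_continuous.
Qed.

(** Recombines the entries with the elementary matrices. *)
Lemma smooth_mx m n (f : V -> 'M[R]_(m, n)) :
  (forall i j, smooth_on U (fun x => f x i j)) -> smooth_on U f.
Proof.
move=> sf.
have s i j : smooth_on U (fun x => f x i j *: delta_mx i j : 'M[R]_(m, n)).
  apply: (@smooth_linear _ _ (fun x => f x i j) (fun a => a *: delta_mx i j)) => //.
    by move=> a u v; rewrite scalerDl scalerA.
  exact: scalel_continuous.
have /= := smooth_sum (index_enum 'I_m) (fun i => smooth_sum (index_enum 'I_n) (s i)).
by apply: eq_smooth => // x _; rewrite -matrix_sum_delta.
Qed.

End Rules.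

End SmoothCalculus.

(** * Scalar products and the conjugates of C *)

Section Dot.
Context {R : realType} {m : nat}.
Implicit Types (u v w : 'cV[R]_m).

Lemma dotE u v : u^T *m v = (dot u v)%:M.
Proof. exact: mx11_scalar. Qed.

Lemma dot_sum u v : dot u v = \sum_i u i 0 * v i 0.
Proof. by rewrite /dot mxE; apply: eq_bigr => i _; rewrite mxE. Qed.

Lemma dotC u v : dot u v = dot v u.
Proof. by rewrite !dot_sum; apply: eq_bigr => i _; rewrite mulrC. Qed.

Lemma dotDl u v w : dot (u + v) w = dot u w + dot v w.
Proof. by rewrite /dot linearD mulmxDl mxE. Qed.

Lemma dotZl a u v : dot (a *: u) v = a * dot u v.
Proof. by rewrite /dot linearZ -scalemxAl mxE. Qed.

Lemma dotNl u v : dot (- u) v = - dot u v.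
Proof. by rewrite -scaleN1r dotZl mulN1r. Qed.

Lemma dot0l v : dot 0 v = 0.
Proof. by rewrite -(scale0r 0) dotZl mul0r. Qed.

Lemma dotDr u v w : dot u (v + w) = dot u v + dot u w.
Proof. by rewrite ![dot u _]dotC dotDl. Qed.

Lemma dotZr a u v : dot u (a *: v) = a * dot u v.
Proof. by rewrite ![dot u _]dotC dotZl. Qed.

Lemma dotNr u v : dot u (- v) = - dot u v.
Proof. by rewrite ![dot u _]dotC dotNl. Qed.

Lemma dot0r v : dot v 0 = 0.
Proof. by rewrite dotC dot0l. Qed.

Definition dotL := (dotDl, dotDr, dotZl, dotZr, dotNl, dotNr, dot0l, dot0r).

Lemma dot_ge0 u : 0 <= dot u u.
Proof. by rewrite dot_sum sumr_ge0 // => i _; rewrite -expr2 sqr_ge0. Qed.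

Lemma dot_eq0 u : dot u u = 0 -> u = 0.
Proof.
rewrite dot_sum => /eqP; rewrite psumr_eq0 => [/allP z|i _]; last first.
  by rewrite -expr2 sqr_ge0.
apply/matrixP => i j; rewrite ord1 [RHS]mxE; apply/eqP.
by have := z i (mem_index_enum _); rewrite -expr2 sqrf_eq0.
Qed.

Lemma dot1_gt0 u : 0 < 1 + dot u u.
Proof. by rewrite ltr_pwDl // dot_ge0. Qed.

Lemma dot1_neq0 u : 1 + dot u u != 0.
Proof. by rewrite gt_eqF // dot1_gt0. Qed.

Lemma dot_mul (h : 'M[R]_m) u v : dot (h *m u) v = dot u (h^T *m v).
Proof. by rewrite /dot trmx_mul mulmxA. Qed.

Lemma dot_isometry (h : 'M[R]_m) u v : h^T *m h = 1%:M ->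
  dot (h *m u) (h *m v) = dot u v.
Proof. by move=> hh; rewrite dot_mul mulmxA hh mul1mx. Qed.

Lemma outer_mul u v w : u *m v^T *m w = dot v w *: u.
Proof. by rewrite -mulmxA dotE mul_mx_scalar. Qed.

Lemma eq_mx_mul k (A B : 'M[R]_(k, m)) : (forall w : 'cV_m, A *m w = B *m w) -> A = B.
Proof.
move=> AB; apply/matrixP => i j; have := AB (delta_mx j 0).
by rewrite -!colE => /matrixP/(_ i 0); rewrite !mxE.
Qed.

End Dot.

Lemma dot_col {R : realType} {n m : nat} (u u' : 'cV[R]_n) (v v' : 'cV[R]_m) :
  dot (col_mx u v) (col_mx u' v') = dot u u' + dot v v'.
Proof. by rewrite /dot tr_col_mx mul_row_col mxE. Qed.

Lemma dot_scalar {R : realType} (a b : R) : dot (a%:M : 'cV_1) b%:M = a * b.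
Proof. by rewrite /dot tr_scalar_mx -scalar_mxM mxE eqxx mulr1n. Qed.

Section Tmx.
Context {R : realType} {n : nat}.
Notation N := (n + 1)%N.
Implicit Types (p v w : 'cV[R]_N) (s a : R) (h : 'M[R]_N).

Definition dg h : 'M[R]_(1 + N) := block_mx 1%:M 0 0 h.

(** For [d = |y|^2] the four scalar entries of [Cmx s y] are [kap s d], [sig s d]
in the first row and [sig s (- d)], [kap s (- d)] in the last one. *)
Definition kap s (d : R) := (s ^+ 2 + 1 + d) / (2 * s).
Definition sig s (d : R) := (s ^+ 2 - 1 + d) / (2 * s).

(** The conjugate [dg h *m Cmx s y *m (dg h)^-1] for any rotation [h] with
[h p0 = p] and [h (y, 0) = v]; see [Cmx_Tmx] and [Tmx_dg]. *)
Definition Tmx p v s : 'M[R]_(1 + N) :=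
  block_mx (kap s (dot v v))%:M (sig s (dot v v) *: p - s^-1 *: v)^T
    (sig s (- dot v v) *: p - v)
    (1%:M + (kap s (- dot v v) - 1) *: (p *m p^T) - v *m p^T
       + s^-1 *: (p *m v^T)).

(** Matrix identities among the [Tmx] are checked on vectors, where they become
rational identities in a few scalar products. *)
Lemma Tmx_act p v s a w :
  Tmx p v s *m col_mx a%:M w =
  col_mx (kap s (dot v v) * a + sig s (dot v v) * dot p w - s^-1 * dot v w)%:M
    ((sig s (- dot v v) * a + (kap s (- dot v v) - 1) * dot p w
        + s^-1 * dot v w) *: p - (a + dot p w) *: v + w).
Proof.
rewrite /Tmx mul_block_col; congr col_mx.
  rewrite -scalar_mxM dotE -raddfD /=; congr (_%:M).
  by rewrite !dotL addrA.
rewrite mul_mx_scalar !mulmxDl mulNmx -!scalemxAl !outer_mul mul1mx.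
by apply/matrixP => i j; rewrite !mxE; ring.
Qed.

Lemma eq_mx_act (A B : 'M[R]_(1 + N)) :
  (forall a w, A *m col_mx a%:M w = B *m col_mx a%:M w) -> A = B.
Proof.
by move=> AB; apply: eq_mx_mul => w; rewrite -[w]vsubmxK [usubmx w]mx11_scalar.
Qed.

Lemma Tmx_mul p v1 v2 s1 s2 : dot p p = 1 -> dot p v1 = 0 -> dot p v2 = 0 ->
  s1 != 0 -> s2 != 0 ->
  Tmx p v1 s1 *m Tmx p v2 s2 = Tmx p (s2 *: v1 + v2) (s1 * s2).
Proof.
move=> pp pv1 pv2 s10 s20; apply: eq_mx_act => a w.
rewrite -mulmxA !Tmx_act /kap /sig.
have v1p : dot v1 p = 0 by rewrite dotC.
have v2p : dot v2 p = 0 by rewrite dotC.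
rewrite !dotL ?pp ?pv1 ?pv2 ?v1p ?v2p ?[dot v2 v1]dotC.
congr col_mx; first by congr (_%:M); field; rewrite s10 s20.
by apply/matrixP => i j; rewrite !mxE; field; rewrite s10 s20.
Qed.

Lemma Tmx1 p : Tmx p 0 1 = 1%:M.
Proof.
apply: eq_mx_act => a w; rewrite Tmx_act mul1mx /kap /sig !dotL.
congr col_mx; first by congr (_%:M); field.
by apply/matrixP => i j; rewrite !mxE; field.
Qed.

(** Equivariance under rotations: the entries of [Tmx] are built from [p], [v]
and their scalar products only. *)
Lemma Tmx_dg h p v s : h^T *m h = 1%:M ->
  dg h *m Tmx p v s = Tmx (h *m p) (h *m v) s *m dg h.
Proof.
move=> hh; rewrite /dg /Tmx !mulmx_block !(mul0mx, mulmx0, mul1mx, mulmx1, addr0, add0r).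
have hhM k (A : 'M[R]_(N, k)) : h^T *m (h *m A) = A by rewrite mulmxA hh mul1mx.
rewrite !dot_isometry//.
congr block_mx.
- rewrite -[RHS]trmxK trmx_mul trmxK.
  by rewrite mulmxBr -!scalemxAr !hhM.
- by rewrite mulmxBr -scalemxAr.
- rewrite !mulmxDr !mulmxDl mulmx1 mul1mx mulmxN mulNmx -!scalemxAr -!scalemxAl.
  rewrite !trmx_mul -!mulmxA hh !mulmx1.
  by rewrite !mulmxA.
Qed.

(** Reversing the axis of a boost inverts it. *)
Lemma Tmx_opp p s : s != 0 -> Tmx (- p) 0 s = Tmx p 0 s^-1.
Proof.
move=> s0; apply: eq_mx_act => a w; rewrite !Tmx_act /kap /sig !dotL.
congr col_mx; first by congr (_%:M); field.
by apply/matrixP => i j; rewrite !mxE; field.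
Qed.

Lemma lorentz_sq : lorentz R n *m lorentz R n = 1%:M.
Proof.
rewrite /lorentz mulmx_block !(mul0mx, mulmx0, mul1mx, mulmx1, addr0, add0r).
by rewrite mulmxN mulNmx opprK mulmx1 -scalar_mx_block.
Qed.

(** The Lorentz adjoint of [Tmx p v s] is its inverse: transposing exchanges the
two off-diagonal vectors, and [lorentz] changes their sign. *)
Lemma Tmx_tr p v s : s != 0 ->
  lorentz R n *m (Tmx p v s)^T *m lorentz R n = Tmx p (- (s^-1 *: v)) s^-1.
Proof.
move=> s0; rewrite /lorentz /Tmx tr_block_mx !mulmx_block.
rewrite !(mul0mx, mulmx0, mul1mx, mulmx1, addr0, add0r, mulmxN, mulNmx, opprK).
have kE : kap s^-1 (- dot (- (s^-1 *: v)) (- (s^-1 *: v))) = kap s (- dot v v).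
  by rewrite /kap !dotL; field.
have kE' : kap s^-1 (dot (- (s^-1 *: v)) (- (s^-1 *: v))) = kap s (dot v v).
  by rewrite /kap !dotL; field.
have sE : sig s^-1 (- dot (- (s^-1 *: v)) (- (s^-1 *: v))) = - sig s (dot v v).
  by rewrite /sig !dotL; field.
have sE' : sig s^-1 (dot (- (s^-1 *: v)) (- (s^-1 *: v))) = - sig s (- dot v v).
  by rewrite /sig !dotL; field.
rewrite {}kE {}kE' {}sE {}sE' !trmxK tr_scalar_mx invrK.
move: (kap _ _) (kap _ _) (sig _ _) (sig _ _) => k k' t t'.
congr block_mx.
- by rewrite -linearN; congr (_^T); apply/matrixP => i j; rewrite !mxE; field.
- by apply/matrixP => i j; rewrite !mxE; ring.
- apply/matrixP => i j; rewrite !mxE !big_ord1 !mxE [j == i]eq_sym.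
  by move: (i == j) => b; field.
Qed.

End Tmx.

(** * Reflections and stereographic projection *)

Section Reflections.
Context {R : realType} {n : nat}.
Notation N := (n + 1)%N.
Implicit Types (x y : 'cV[R]_n) (p v w : 'cV[R]_N) (s a : R).
Notation e := (@p0 R n).

Definition pole_vec x : 'cV[R]_N := col_mx x (-1)%:M.

(** The reflection in the hyperplane orthogonal to [(x, -1)].  That vector is
proportional to [stereo_inv x - p0], so the reflection exchanges the pole and
[stereo_inv x]. *)
Definition refl x : 'M[R]_N :=
  1%:M - (2 / (1 + dot x x)) *: (pole_vec x *m (pole_vec x)^T).

Lemma dot_pole_vec x : dot (pole_vec x) (pole_vec x) = 1 + dot x x.
Proof. by rewrite /pole_vec dot_col dot_scalar mulrNN mul1r addrC. Qed.

Lemma dot_pole_vec_p0 x : dot (pole_vec x) e = -1.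
Proof. by rewrite /pole_vec /p0 dot_col dot_scalar dot0r add0r mulr1. Qed.

Lemma refl_act x w :
  refl x *m w = w - (2 / (1 + dot x x) * dot (pole_vec x) w) *: pole_vec x.
Proof. by rewrite mulmxBl mul1mx -scalemxAl outer_mul scalerA. Qed.

Lemma refl_tr x : (refl x)^T = refl x.
Proof. by rewrite /refl linearB linearZ /= trmx1 trmx_mul trmxK. Qed.

Lemma refl_sq x : refl x *m refl x = 1%:M.
Proof.
apply: eq_mx_mul => w; rewrite -mulmxA mul1mx [refl x *m w]refl_act refl_act.
rewrite !dotL dot_pole_vec; apply/matrixP => i j; rewrite !mxE.
by field; rewrite dot1_neq0.
Qed.

Lemma reflK k x (A : 'M[R]_(N, k)) : refl x *m (refl x *m A) = A.
Proof. by rewrite mulmxA refl_sq mul1mx. Qed.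

Lemma refl_orth x : (refl x)^T *m refl x = 1%:M.
Proof. by rewrite refl_tr refl_sq. Qed.

Lemma dot_refl x v w : dot (refl x *m v) (refl x *m w) = dot v w.
Proof. by rewrite dot_isometry// refl_orth. Qed.

Lemma dot_p0 : dot e e = 1.
Proof. by rewrite /p0 dot_col dot0l dot_scalar add0r mulr1. Qed.

Lemma dot_p0_col y a : dot e (col_mx y a%:M) = a.
Proof. by rewrite /p0 dot_col dot0l dot_scalar add0r mul1r. Qed.

Lemma dot1_neq0C x : dot x x + 1 != 0.
Proof. by rewrite addrC dot1_neq0. Qed.

Lemma stereo_invE x : stereo_inv x = e + (2 / (1 + dot x x)) *: pole_vec x.
Proof.
rewrite /stereo_inv /p0 /pole_vec scale_col_mx add_col_mx add0r; congr col_mx.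
rewrite scale_scalar_mx -raddfD /=; congr (_%:M).
by field; rewrite ?dot1_neq0 ?dot1_neq0C.
Qed.

Lemma refl_p0 x : refl x *m e = stereo_inv x.
Proof. by rewrite refl_act stereo_invE dot_pole_vec_p0 mulrN1 scaleNr opprK. Qed.

Lemma sphere_stereo_inv x : sphere (stereo_inv x).
Proof. by rewrite /sphere /= -refl_p0 dot_refl dot_p0. Qed.

Lemma stereo_inv_neq x : stereo_inv x <> e.
Proof.
rewrite stereo_invE => /(congr1 (fun z => - e + z)); rewrite addKr addNr.
move=> /(congr1 (dot e)); rewrite dotZr dotC dot_pole_vec_p0 dot0r mulrN1 => /eqP.
by rewrite oppr_eq0 mulf_eq0 invr_eq0 (negbTE (dot1_neq0 _)) pnatr_eq0.
Qed.

Lemma stereo_invK : cancel (@stereo_inv R n) (@stereo R n).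
Proof.
move=> x; rewrite /stereo /stereo_inv col_mxKu col_mxKd mxE eqxx mulr1n scalerA.
rewrite -[RHS]scale1r; congr (_ *: _).
field.
rewrite ?dot1_neq0 ?dot1_neq0C /=.
by rewrite (_ : _ - _ = 2) ?pnatr_eq0 //; ring.
Qed.

Lemma sphere_col p : sphere p ->
  dot (usubmx p) (usubmx p) + dsubmx p 0 0 ^+ 2 = 1.
Proof.
rewrite /sphere /= -{1 2}[p]vsubmxK dot_col => <-; congr (_ + _).
by rewrite [dsubmx p]mx11_scalar dot_scalar !mxE eqxx mulr1n.
Qed.

(** A unit vector with last coordinate 1 has no room for other coordinates. *)
Lemma sphere_pole p : sphere p -> (p <> e) <-> (dsubmx p 0 0 != 1).
Proof.
move=> Sp; split; last first.
  by move=> + pe; rewrite pe /p0 col_mxKd mxE eqxx => /eqP.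
move=> pe; apply/eqP => p1; apply: pe.
have := sphere_col Sp; rewrite p1 expr1n => /(canRL (addrK _)).
rewrite subrr => /dot_eq0 u0.
by rewrite -[p]vsubmxK u0 [dsubmx p]mx11_scalar p1.
Qed.

Lemma stereoK p : sphere p -> p <> e -> stereo_inv (stereo p) = p.
Proof.
move=> Sp /(sphere_pole Sp) p1.
have := sphere_col Sp; set a := dsubmx p 0 0 in p1 *; set u := usubmx p => ua.
have a1 : 1 - a != 0 by rewrite subr_eq0 eq_sym.
have ru : dot u u = (1 - a) * (1 + a) by rewrite -subr_sqr expr1n -ua addrK.
have rx : dot (stereo p) (stereo p) = (1 + a) / (1 - a).
  by rewrite /stereo -/a -/u !dotL ru; field.
have d2 : 1 + (1 + a) / (1 - a) = 2 / (1 - a) by field.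
have d2' : (1 + a) / (1 - a) + 1 = 2 / (1 - a) by field.
rewrite /stereo_inv rx d2 d2' /stereo -/a -/u -[RHS]vsubmxK -/u.
congr col_mx; first by rewrite scalerA -[RHS]scale1r; congr (_ *: _); field.
by rewrite [dsubmx p]mx11_scalar -/a; congr (_%:M); field.
Qed.

Lemma eq_mx_col (A B : 'M[R]_N) :
  (forall y a, A *m col_mx y a%:M = B *m col_mx y a%:M) -> A = B.
Proof.
by move=> AB; apply: eq_mx_mul => w; rewrite -[w]vsubmxK [dsubmx w]mx11_scalar.
Qed.

(** Two unipotent row operations, [L1] and then [L2], bring [refl x] to block
triangular form with last pivot -1. *)
Lemma det_refl x : \det (refl x) = -1.
Proof.
pose c := 2 / (1 + dot x x).
have rE : refl x = block_mx (1%:M - c *: (x *m x^T)) (c *: x) (c *: x^T) (1 - c)%:M.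
  apply: eq_mx_col => y a; rewrite refl_act /pole_vec dot_col dot_scalar -/c.
  rewrite mul_block_col scale_col_mx opp_col_mx add_col_mx; congr col_mx.
    rewrite mulmxBl mul1mx -!scalemxAl outer_mul mul_mx_scalar.
    by apply/matrixP => i j; rewrite !mxE; ring.
  rewrite -scalemxAl dotE -scalar_mxM !scale_scalar_mx -!raddfN -!raddfD /=.
  by congr (_%:M); ring.
pose L1 : 'M[R]_N := block_mx 1%:M x 0 1%:M.
pose L2 : 'M[R]_N := block_mx 1%:M 0 (- (c *: x^T)) 1%:M.
have : L2 *m (L1 *m refl x) = block_mx 1%:M x 0 (-1)%:M.
  rewrite rE !mulmx_block !(mul0mx, mulmx0, mul1mx, mulmx1, addr0, add0r).
  have -> : 1%:M - c *: (x *m x^T) + x *m (c *: x^T) = 1%:M.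
    by rewrite -scalemxAr subrK.
  have -> : c *: x + x *m (1 - c)%:M = x.
    by rewrite mul_mx_scalar -scalerDl addrC subrK scale1r.
  congr block_mx; first by rewrite mulmx1 addNr.
  rewrite mulNmx -scalemxAl dotE scale_scalar_mx -raddfN -raddfD /=; congr (_%:M).
  by rewrite /c; field; rewrite dot1_neq0.
move=> /(congr1 determinant); rewrite !det_mulmx det_ublock det_ublock det_lblock.
by rewrite !det1 !mul1r det_scalar1.
Qed.

Lemma Cmx_Tmx s y : s != 0 -> Cmx s y = Tmx e (col_mx y 0) s.
Proof.
move=> s0; apply: eq_mx_act => a w; rewrite -[w]vsubmxK [dsubmx w]mx11_scalar.
move: (usubmx w) (dsubmx w 0 0) => {w} u b.
rewrite Tmx_act /Cmx mul_block_col mul_block_col mul_row_col mul_col_mx.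
rewrite !dot_col !dot0l !dot_scalar ?mul0r ?mul1r ?addr0 ?add0r.
rewrite /p0 !scale_col_mx opp_col_mx !add_col_mx; congr col_mx.
  rewrite mulNmx -scalemxAl dotE scale_scalar_mx -!scalar_mxM -raddfN -!raddfD /=.
  by congr (_%:M); rewrite /kap /sig; field.
congr col_mx.
  by rewrite !mul_mx_scalar mul1mx; apply/matrixP => i j; rewrite !mxE; ring.
rewrite -scalemxAl dotE !scaler0 oppr0 !scale_scalar_mx -!scalar_mxM addr0 -!raddfD /=.
by congr (_%:M); rewrite /kap /sig; field.
Qed.

(** The Iwasawa decomposition of [dg (refl 0) *m Cmx 1 (- x)], whose rotation
factor is [refl x].  It is the only reflection identity that has to be computed;
[refl_Cmx] follows from it inside the group C. *)
Lemma refl_Tmx x :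
  dg (refl 0) *m Tmx e (- col_mx x 0) 1 =
  Tmx e (- col_mx x 0) (1 + dot x x) *m dg (refl x).
Proof.
apply: eq_mx_act => a w; rewrite -!mulmxA.
have dgE h b v : dg h *m col_mx b%:M v = col_mx b%:M (h *m v) :> 'cV[R]_(1 + N).
  by rewrite /dg mul_block_col !mul0mx mul1mx addr0 add0r.
rewrite dgE !Tmx_act dgE /kap /sig !refl_act !dotL.
have -> : pole_vec x = col_mx x 0 - e.
  by rewrite /pole_vec /p0 opp_col_mx add_col_mx subr0 add0r raddfN.
have -> : pole_vec 0 = - e.
  by rewrite /pole_vec /p0 opp_col_mx oppr0 raddfN.
have xe : dot (col_mx x 0) e = 0 by rewrite /p0 dot_col dot0l dot0r addr0.
have ex : dot e (col_mx x 0) = 0 by rewrite dotC.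
have xx : dot (col_mx x 0 : 'cV[R]_N) (col_mx x 0) = dot x x.
  by rewrite dot_col dot0l addr0.
rewrite !dotL dot_p0 ?xe ?ex ?xx.
have d0 := dot1_neq0 x.
congr col_mx; first by congr (_%:M); field; rewrite ?d0.
by apply/matrixP => i j; rewrite !mxE; field; rewrite ?d0.
Qed.

End Reflections.

(** * Iwasawa factors *)

Section Iwasawa.
Context {R : realType} {n : nat}.
Notation N := (n + 1)%N.
Implicit Types (x y : 'cV[R]_n) (p v w : 'cV[R]_N) (s a : R) (h : 'M[R]_N).
Implicit Types (g b c : 'M[R]_(1 + N)) (z : Zamb R n).
Notation e := (@p0 R n).

Lemma dot_p0_col0 y : dot e (col_mx y 0) = 0.
Proof. by rewrite /p0 dot_col dot0l dot0r addr0. Qed.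

Lemma Cmx_mul s1 s2 y1 y2 : s1 != 0 -> s2 != 0 ->
  Cmx s1 y1 *m Cmx s2 y2 = Cmx (s1 * s2) (s2 *: y1 + y2).
Proof.
move=> s10 s20; rewrite !Cmx_Tmx ?mulf_neq0// Tmx_mul ?dot_p0 ?dot_p0_col0//.
by rewrite scale_col_mx add_col_mx scaler0 addr0.
Qed.

Lemma Cmx1 : Cmx 1 0 = 1%:M :> 'M[R]_(1 + N).
Proof. by rewrite Cmx_Tmx ?oner_eq0// col_mx0 Tmx1. Qed.

Lemma CmxV s y : s != 0 -> Cmx s y *m Cmx s^-1 (- (s^-1 *: y)) = 1%:M.
Proof. by move=> s0; rewrite Cmx_mul ?invr_eq0// divff// subrr Cmx1. Qed.

Lemma CmxVl s y : s != 0 -> Cmx s^-1 (- (s^-1 *: y)) *m Cmx s y = 1%:M.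
Proof. by move=> /CmxV/mulmx1C. Qed.

Lemma C_Cmx s y : 0 < s -> C (Cmx s y).
Proof. by move=> s0; exists s, y. Qed.

Lemma C_mul c1 c2 : C c1 -> C c2 -> C (c1 *m c2).
Proof.
move=> [s1 [y1 [s10 ->]]] [s2 [y2 [s20 ->]]].
by rewrite Cmx_mul ?gt_eqF//; apply: C_Cmx; rewrite mulr_gt0.
Qed.

Lemma C_inv c : C c -> exists2 c', C c' & c' *m c = 1%:M.
Proof.
move=> [s [y [s0 ->]]]; exists (Cmx s^-1 (- (s^-1 *: y))).
  by apply: C_Cmx; rewrite invr_gt0.
by rewrite CmxVl// gt_eqF.
Qed.

Lemma invmx_unique k (A B : 'M[R]_k) : A *m B = 1%:M -> invmx B = A.
Proof.
move=> AB; have [_ uB] := mulmx1_unit AB.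
by rewrite -[RHS]mulmx1 -(mulmxV uB) mulmxA AB mul1mx.
Qed.

Lemma C_invmx c : C c -> C (invmx c).
Proof. by move=> /C_inv[c' Cc'] /invmx_unique->. Qed.

Lemma C_unit c : C c -> c \in unitmx.
Proof. by move=> /C_inv[c' _] /mulmx1_unit[]. Qed.

Lemma C1 : C (1%:M : 'M[R]_(1 + N)).
Proof. by rewrite -Cmx1; exact: C_Cmx. Qed.

Lemma Cmx_lorentz s y : s != 0 ->
  (Cmx s y)^T *m lorentz R n *m Cmx s y = lorentz R n.
Proof.
move=> s0; have := Tmx_tr e (col_mx y 0) s0; rewrite -Cmx_Tmx//.
have -> : - (s^-1 *: col_mx y 0) = col_mx (- (s^-1 *: y)) 0 :> 'cV[R]_N.
  by rewrite scale_col_mx scaler0 opp_col_mx oppr0.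
rewrite -Cmx_Tmx ?invr_eq0// => E.
have -> : (Cmx s y)^T *m lorentz R n = lorentz R n *m Cmx s^-1 (- (s^-1 *: y)).
  by rewrite -E !mulmxA lorentz_sq mul1mx.
by rewrite -mulmxA CmxVl// mulmx1.
Qed.

Lemma det_lorentz_sq g : g^T *m lorentz R n *m g = lorentz R n -> \det g ^+ 2 = 1.
Proof.
move=> /(congr1 determinant); rewrite !det_mulmx det_tr mulrAC -expr2.
have dl : \det (lorentz R n) != 0.
  have := congr1 determinant (@lorentz_sq R n); rewrite det_mulmx det1 => dd.
  by apply/eqP => d0; move: dd; rewrite d0 mul0r => /eqP; rewrite eq_sym oner_eq0.
by move=> /(canRL (mulfK dl)); rewrite divff.
Qed.

(** The Lorentz condition only gives [det = 1] or [det = -1]; but [Cmx s y] is the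
square of an element of C. *)
Lemma det_Cmx s y : 0 < s -> \det (Cmx s y) = 1.
Proof.
move=> s0; pose t := Num.sqrt s; have t0 : 0 < t by rewrite sqrtr_gt0.
(* by [Cmx_mul], (t, y')^2 = (t^2, (t + 1) y') *)
have -> : Cmx s y = Cmx t ((t + 1)^-1 *: y) *m Cmx t ((t + 1)^-1 *: y).
  rewrite Cmx_mul ?gt_eqF// -expr2 sqr_sqrtr ?ltW//; congr Cmx.
  rewrite -[X in _ + X]scale1r -scalerDl scalerA divff ?scale1r//.
  by rewrite gt_eqF // addr_gt0.
by rewrite det_mulmx -expr2 det_lorentz_sq// Cmx_lorentz// gt_eqF.
Qed.

Lemma C_SO1 c : C c -> SO1 c.
Proof.
move=> [s [y [s0 ->]]]; split; first by rewrite Cmx_lorentz// gt_eqF.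
exact: det_Cmx.
Qed.

Lemma dg_mul h1 h2 : dg (h1 *m h2) = dg h1 *m dg h2.
Proof.
by rewrite /dg mulmx_block !(mul0mx, mulmx0, mul1mx, addr0, add0r).
Qed.

Lemma dg1 : dg (1%:M : 'M[R]_N) = 1%:M.
Proof. by rewrite /dg -scalar_mx_block. Qed.

Lemma dg_inj : injective (@dg R n).
Proof. by move=> h1 h2 /eq_block_mx[]. Qed.

Lemma SO_mul k (h1 h2 : 'M[R]_k) : SO k h1 -> SO k h2 -> SO k (h1 *m h2).
Proof.
move=> [ho1 d1] [ho2 d2]; split; last by rewrite det_mulmx d1 d2 mulr1.
by rewrite trmx_mul -mulmxA (mulmxA _ h1) ho1 mul1mx.
Qed.

Lemma SO_id k : SO k (1%:M : 'M[R]_k).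
Proof. by split; [rewrite trmx1 mulmx1|rewrite det1]. Qed.

Lemma SO_tr k (h : 'M[R]_k) : SO k h -> SO k h^T.
Proof. by move=> [/mulmx1C ho d]; split; rewrite ?trmxK ?det_tr. Qed.

Lemma SO_refl x x' : SO N (refl x *m refl x').
Proof.
split; last by rewrite det_mulmx !det_refl mulrNN mulr1.
by rewrite trmx_mul !refl_tr -mulmxA reflK refl_sq.
Qed.

Lemma SO_trK k l (h : 'M[R]_k) (A : 'M[R]_(k, l)) : SO k h -> h^T *m (h *m A) = A.
Proof. by move=> [ho _]; rewrite mulmxA ho mul1mx. Qed.

Lemma SO_Ktr k l (h : 'M[R]_k) (A : 'M[R]_(k, l)) : SO k h -> h *m (h^T *m A) = A.
Proof. by move=> /SO_tr/(SO_trK A); rewrite trmxK. Qed.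

Lemma B_dg h : SO N h -> B (dg h).
Proof. by move=> ho; exists h. Qed.

Lemma dg_SO1 h : SO N h -> SO1 (dg h).
Proof.
move=> [ho d]; split.
  rewrite /dg /lorentz tr_block_mx !mulmx_block.
  rewrite !(mul0mx, mulmx0, mul1mx, mulmx1, trmx1, trmx0, addr0, add0r).
  by rewrite mulmxN mulmx1 mulNmx ho.
by rewrite /dg det_ublock det1 mul1r.
Qed.

(** A right factor [dg h] does not change the first column, so the parameters
[s], [y] of the C-factor of [c *m dg h] can be read off that column. *)
Definition sfac g : R := ulsubmx g 0 0 + dsubmx (dlsubmx g) 0 0.
Definition yfac g : 'cV[R]_n := - usubmx (dlsubmx g).
Definition bfac g : 'M[R]_N :=
  drsubmx (Cmx (sfac g)^-1 (- ((sfac g)^-1 *: yfac g)) *m g).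

Lemma ulsubmx_mul_dg g h : ulsubmx (g *m dg h) = ulsubmx g.
Proof.
by rewrite -[g]submxK /dg mulmx_block !block_mxKul mulmx1 mulmx0 addr0.
Qed.

Lemma dlsubmx_mul_dg g h : dlsubmx (g *m dg h) = dlsubmx g.
Proof.
by rewrite -[g]submxK /dg mulmx_block !block_mxKdl mulmx1 mulmx0 addr0.
Qed.

Lemma sfacE s y h : s != 0 -> sfac (Cmx s y *m dg h) = s.
Proof.
move=> s0; rewrite /sfac ulsubmx_mul_dg dlsubmx_mul_dg /Cmx block_mxKul block_mxKdl.
by rewrite col_mxKd !mxE eqxx !mulr1n; field.
Qed.

Lemma yfacE s y h : yfac (Cmx s y *m dg h) = y.
Proof.
by rewrite /yfac dlsubmx_mul_dg /Cmx block_mxKdl col_mxKu opprK.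
Qed.

Lemma bfacE c h : C c -> bfac (c *m dg h) = h.
Proof.
move=> [s [y [s0 ->]]]; rewrite /bfac sfacE ?gt_eqF// yfacE mulmxA.
by rewrite CmxVl ?gt_eqF// mul1mx /dg block_mxKdr.
Qed.

Lemma Iwasawa_unique c1 c2 h1 h2 : C c1 -> C c2 ->
  c1 *m dg h1 = c2 *m dg h2 -> c1 = c2 /\ h1 = h2.
Proof.
move=> C1 C2 E; split; last by rewrite -(bfacE h1 C1) E bfacE.
case: C1 C2 E => [s1 [y1 [s10 ->]]] [s2 [y2 [s20 ->]]] E.
have := congr1 sfac E; rewrite !sfacE ?gt_eqF// => <-.
by have := congr1 yfac E; rewrite !yfacE => <-.
Qed.

(** The rotation factor of [Tmx] at [z]; the definition by [sfac] and [yfac] makes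
it a rational function of [z]. *)
Definition coc z : 'M[R]_N := bfac (Tmx z.1.1 z.1.2 z.2).

(** Coordinates on [Z1] in which [y] has the Euclidean length of the tangent
vector; see [kappaE] for the relation with [kappa]. *)
Definition Zcoord x y s : Zamb R n := (stereo_inv x, refl x *m col_mx y 0, s).

Lemma dg_refl_sq x : dg (refl x) *m dg (refl x) = 1%:M.
Proof. by rewrite -dg_mul refl_sq dg1. Qed.

Lemma dg_refl_Cmx x : exists2 c, C c & dg (refl x) = c *m dg (refl 0) *m Cmx 1 (- x).
Proof.
have := refl_Tmx x.
have -> : - col_mx x 0 = col_mx (- x) 0 :> 'cV[R]_N by rewrite opp_col_mx oppr0.
rewrite -!Cmx_Tmx ?dot1_neq0 ?oner_eq0// => E.
have [c Cc c1] := C_inv (C_Cmx (- x) (dot1_gt0 x)).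
by exists c => //; rewrite -mulmxA E mulmxA c1 mul1mx.
Qed.

(** Writing [dg (refl x) = c *m dg (refl 0) *m Cmx 1 (- x)] with [c] in C, and
likewise the inverse of [dg (refl x2)], the middle factor becomes
[Cmx 1 (- x) *m Cmx s y *m Cmx 1 x2 = Cmx s 0], because [x2 = s x - y].
Conjugation by [refl 0] turns this dilation into [Cmx s^-1 0]. *)
Lemma refl_Cmx x y s : 0 < s ->
  C (dg (refl x) *m Cmx s y *m dg (refl (s *: x - y))).
Proof.
move=> s0; set x2 := s *: x - y.
have [c Cc ->] := dg_refl_Cmx x.
have [c2 Cc2 E2] := dg_refl_Cmx x2.
have [c2' Cc2' c2K] := C_inv Cc2.
have -> : dg (refl x2) = Cmx 1 x2 *m dg (refl 0) *m c2'.
  have [uR _] := mulmx1_unit (dg_refl_sq x2).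
  apply: (can_inj (mulKmx uR)).
  rewrite dg_refl_sq {1}E2 -!mulmxA (mulmxA (Cmx 1 (- x2))) Cmx_mul ?oner_eq0//.
  rewrite mul1r scale1r addNr Cmx1 mul1mx (mulmxA (dg _)) dg_refl_sq mul1mx.
  exact/esym/mulmx1C.
rewrite -!mulmxA; apply: C_mul => //; rewrite !mulmxA; apply: C_mul => //.
rewrite -!mulmxA (mulmxA (Cmx _ _)) Cmx_mul ?gt_eqF// (mulmxA (Cmx _ _)).
rewrite Cmx_mul ?mulf_neq0 ?gt_eqF// !mul1r mulr1 scale1r.
have -> : s *: - x + y + x2 = 0.
  by rewrite /x2 scalerN addrACA addNr add0r subrr.
rewrite Cmx_Tmx ?gt_eqF// col_mx0 mulmxA Tmx_dg ?refl_orth// mulmx0.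
have -> : refl 0 *m e = - e.
  rewrite refl_p0 /stereo_inv /p0 dot0l scaler0 opp_col_mx oppr0; congr col_mx.
  by rewrite !add0r divr1 raddfN.
rewrite Tmx_opp ?gt_eqF// -mulmxA dg_refl_sq mulmx1.
by rewrite -(@col_mx0 R n 1 1) -Cmx_Tmx ?invr_eq0 ?gt_eqF//; apply: C_Cmx; rewrite invr_gt0.
Qed.

Lemma Tmx_Zcoord x y s : 0 < s ->
  Tmx (stereo_inv x) (refl x *m col_mx y 0) s =
  (dg (refl x) *m Cmx s y *m dg (refl (s *: x - y))) *m
    dg (refl (s *: x - y) *m refl x).
Proof.
move=> s0; move: (s *: x - y) => x2.
rewrite (dg_mul (refl x2)) -(mulmxA _ (dg (refl x2))) (mulmxA (dg (refl x2))).
rewrite dg_refl_sq mul1mx Cmx_Tmx ?gt_eqF// Tmx_dg ?refl_orth// refl_p0 -mulmxA.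
by rewrite dg_refl_sq mulmx1.
Qed.

Lemma coc_Zcoord x y s : 0 < s ->
  coc (Zcoord x y s) = refl (s *: x - y) *m refl x.
Proof. by move=> s0; rewrite /coc /= Tmx_Zcoord// bfacE//; exact: refl_Cmx. Qed.

Lemma coc_F0coord s y : 0 < s -> coc (F0coord s y) = 1%:M.
Proof.
move=> s0; rewrite /coc /= -Cmx_Tmx ?gt_eqF// -[Cmx s y]mulmx1 -dg1 bfacE//.
exact: C_Cmx.
Qed.

Lemma p0_tangent v : dot e v = 0 -> v = col_mx (usubmx v) 0.
Proof.
rewrite -{1 2}[v]vsubmxK [dsubmx v]mx11_scalar dot_p0_col => ->.
by rewrite raddf0.
Qed.

(** Statements about a point of Z are proved separately on [F0] and on [Z1], in
the respective coordinates. *)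
Variant Zset_spec z : Prop :=
| ZsetF0 s y of 0 < s & z = F0coord s y
| ZsetZ1 x y s of 0 < s & z = Zcoord x y s.

Lemma ZsetP z : Zset z -> Zset_spec z.
Proof.
case: z => -[p v] s [[/= Sp pv] s0].
have [pe|pe] := pselect (p = e).
  apply: (@ZsetF0 _ s (usubmx v)) => //.
  by rewrite /F0coord {1}pe -p0_tangent// -pe.
apply: (@ZsetZ1 _ (stereo p) (usubmx (refl (stereo p) *m v)) s) => //.
rewrite /Zcoord stereoK// -p0_tangent ?reflK//.
by rewrite -(dot_refl (stereo p)) refl_p0 stereoK// reflK.
Qed.

Lemma Zset_Zcoord x y s : 0 < s -> Zset (Zcoord x y s).
Proof.
move=> s0; split=> //; split; first exact: sphere_stereo_inv.
by rewrite /= -refl_p0 dot_refl dot_p0_col0.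
Qed.

Lemma Zset_F0coord y s : 0 < s -> Zset (F0coord s y).
Proof. by move=> s0; split=> //; split; rewrite /sphere/= ?dot_p0// dot_p0_col0. Qed.

(** Both coordinate systems exhibit the decomposition explicitly. *)
Lemma coc_Iwasawa z : Zset z ->
  exists2 c, C c & Tmx z.1.1 z.1.2 z.2 = c *m dg (coc z).
Proof.
case/ZsetP => [s y s0 ->|x y s s0 ->].
  exists (Cmx s y); first exact: C_Cmx.
  by rewrite coc_F0coord// dg1 mulmx1 /= -Cmx_Tmx ?gt_eqF.
exists (dg (refl x) *m Cmx s y *m dg (refl (s *: x - y))); first exact: refl_Cmx.
by rewrite coc_Zcoord//; exact: Tmx_Zcoord.
Qed.

Lemma coc_SO z : Zset z -> SO N (coc z).
Proof.
case/ZsetP => [s y s0 ->|x y s s0 ->].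
  by rewrite coc_F0coord//; exact: SO_id.
by rewrite coc_Zcoord//; exact: SO_refl.
Qed.

Lemma coc_unit p : coc (p, 0, 1) = 1%:M.
Proof.
by rewrite /coc /= Tmx1 -[1%:M]mulmx1 -[X in _ *m X]dg1 bfacE//; exact: C1.
Qed.

(** * The groupoid of the cocycle *)

(** The structure maps that the quotient relations turn out to define; see
[graph_stildeE] and [graph_mtildeE]. *)
Definition zmul z1 z2 : Zamb R n :=
  (z1.1.1, z2.2 *: z1.1.2 + (coc z1)^T *m z2.1.2, z1.2 * z2.2).
Definition zinv z : Zamb R n :=
  (coc z *m z.1.1, - (z.2^-1 *: (coc z *m z.1.2)), z.2^-1).
Definition zl z : Zamb R n := (z.1.1, 0, 1).
Definition zr z : Zamb R n := (coc z *m z.1.1, 0, 1).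

Lemma dot_SO k (h : 'M[R]_k) (u v : 'cV[R]_k) : SO k h -> dot (h *m u) (h *m v) = dot u v.
Proof. by case=> O _; exact: dot_isometry. Qed.

Lemma Zset_zmul z1 z2 : Zset z1 -> Zset z2 -> coc z1 *m z1.1.1 = z2.1.1 ->
  Zset (zmul z1 z2).
Proof.
move=> Z1 Z2 E; have S1 := coc_SO Z1.
case: Z1 => -[/= p1 pv1] s1; case: Z2 => -[/= p2 pv2] s2.
split; last by rewrite /= mulr_gt0.
split=> //=; rewrite !dotL pv1 mulr0 add0r -(dot_SO _ _ S1) SO_Ktr// E.
exact: pv2.
Qed.

(** The factor [dg (coc z1)] can be moved past the second [Tmx], which becomes
[Tmx] at [z2]; the product of the two decompositions is then a decomposition of
[Tmx (zmul z1 z2)], and the rotation factor is unique. *)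
Lemma coc_zmul z1 z2 : Zset z1 -> Zset z2 -> coc z1 *m z1.1.1 = z2.1.1 ->
  coc (zmul z1 z2) = coc z2 *m coc z1.
Proof.
move=> Z1 Z2 E; have S1 := coc_SO Z1.
have [c1 Cc1 E1] := coc_Iwasawa Z1; have [c2 Cc2 E2] := coc_Iwasawa Z2.
case: (Z1) => -[/= p1 pv1] s1; case: (Z2) => -[/= p2 pv2] s2.
rewrite {1}/coc /= -Tmx_mul ?gt_eqF//; last first.
  by rewrite -(dot_SO _ _ S1) SO_Ktr// E.
rewrite E1 -mulmxA Tmx_dg; last by case: S1.
rewrite E SO_Ktr// E2 !mulmxA -mulmxA -dg_mul bfacE//; exact: C_mul.
Qed.

Lemma Zset_zinv z : Zset z -> Zset (zinv z).
Proof.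
move=> Zz; have Sz := coc_SO Zz; case: Zz => -[/= p1 pv1] s1.
split; last by rewrite /= invr_gt0.
by split; rewrite /sphere/= ?dotL dot_SO// pv1 mulr0 oppr0.
Qed.

Lemma zmul_zinv z : Zset z -> zmul z (zinv z) = zl z.
Proof.
move=> Zz; have Sz := coc_SO Zz; case: (Zz) => -[/= p1 pv1] s1.
rewrite /zmul /zinv /zl /= divff ?gt_eqF//; congr (_, _, _).
by rewrite mulmxN -scalemxAr SO_trK// subrr.
Qed.

(** Apply the cocycle identity to [zmul z (zinv z)], which is a unit. *)
Lemma coc_zinv z : Zset z -> coc (zinv z) = (coc z)^T.
Proof.
move=> Zz; have Sz := coc_SO Zz.
have := coc_zmul Zz (Zset_zinv Zz) erefl; rewrite zmul_zinv// coc_unit.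
move=> /esym/(congr1 (mulmx^~ (coc z)^T)).
by rewrite -mulmxA (mulmx1C (proj1 Sz)) mulmx1 mul1mx.
Qed.

Lemma zinvK z : Zset z -> zinv (zinv z) = z.
Proof.
move=> Zz; have Sz := coc_SO Zz; have : 0 < z.2 by case: Zz.
rewrite /zinv coc_zinv//=; case: z Zz Sz => -[p v] s /= Zz Sz s0.
rewrite invrK SO_trK// mulmxN -scalemxAr SO_trK// scalerN opprK scalerA.
by rewrite divff ?gt_eqF// scale1r.
Qed.

Definition Zunits : set (Zamb R n) := [set (p, 0, 1) | p in sphere].

Lemma Zset_unit p : sphere p -> Zset (p, 0, 1).
Proof. by move=> Sp; split => //=; split=> //=; rewrite dot0r. Qed.

Lemma composableE z1 z2 : composable Zset zl zr (z1, z2) <->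
  [/\ Zset z1, Zset z2 & coc z1 *m z1.1.1 = z2.1.1].
Proof.
by split=> -[/= Z1 Z2 E]; split=> //; [case: E|rewrite /zl /zr E].
Qed.

Lemma Z_groupoid : is_groupoid Zset Zunits zl zr zinv zmul.
Proof.
have mE z1 z2 : composable Zset zl zr (z1, z2) ->
    [/\ Zset z1, Zset z2, coc z1 *m z1.1.1 = z2.1.1,
    Zset (zmul z1 z2) & coc (zmul z1 z2) = coc z2 *m coc z1].
  by move=> /composableE[Z1 Z2 E]; split=> //; [exact: Zset_zmul|exact: coc_zmul].
split.
- by move=> _ [p Sp <-]; exact: Zset_unit.
- by move=> z [[Sp _] _]; exists z.1.1.
- move=> z Zz; exists (coc z *m z.1.1) => //.
  by rewrite /sphere /= dot_SO; [case: Zz => -[]|exact: coc_SO].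
- by move=> _ [p Sp <-].
- by move=> _ [p Sp <-]; rewrite /zr coc_unit mul1mx.
- exact: Zset_zinv.
- by move=> x y /mE[].
- by [].
- move=> x y /mE[Z1 Z2 E _ mm].
  by rewrite /zr mm /= -mulmxA E.
- move=> x y z /mE[Zx Zy Exy Zxy mxy] /mE[_ Zz Eyz Zyz myz].
  rewrite /zmul -/(zmul x y) mxy /=; congr (_, _, _); last by rewrite mulrA.
  by rewrite scalerDr scalerA mulmxDr -scalemxAr trmx_mul mulmxA addrA [_ * y.2]mulrC.
- move=> [[p v] s] Zz; rewrite /zmul /zl /= coc_unit trmx1 mul1mx scaler0 add0r.
  by rewrite mul1r.
- move=> [[p v] s] Zz; rewrite /zmul /zr /= mulmx0 scale1r addr0.
  by rewrite mulr1.
- by [].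
- by move=> z Zz; rewrite /zr coc_zinv//= SO_trK//; exact: coc_SO.
- exact: zmul_zinv.
- move=> z Zz; rewrite -{2}(zinvK Zz) zmul_zinv; last exact: Zset_zinv.
  by [].
Qed.

End Iwasawa.

(** * Smooth families of matrices *)

Section SmoothMatrices.
Context {R : realType} {V : normedModType R} {U : set V} (oU : open U).

Lemma smooth_scale k l (f : V -> R) (A : V -> 'M[R]_(k, l)) :
  smooth_on U f -> smooth_on U A -> smooth_on U (fun x => f x *: A x).
Proof.
move=> sf sA; apply: smooth_mx => // i j.
by apply: (eq_smooth oU _ (smoothM oU sf (smooth_entry oU i j sA))) => x _; rewrite mxE.
Qed.

Lemma smooth_mulmx k l m (A : V -> 'M[R]_(k, l)) (A' : V -> 'M[R]_(l, m)) :
  smooth_on U A -> smooth_on U A' -> smooth_on U (fun x => A x *m A' x).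
Proof.
move=> sA sA'; apply: smooth_mx => // i j.
apply: (eq_smooth oU _ (smooth_sum oU (index_enum 'I_l)
  (fun k => smoothM oU (smooth_entry oU i k sA) (smooth_entry oU k j sA')))) => x _.
by rewrite mxE.
Qed.

Lemma smooth_tr k l (A : V -> 'M[R]_(k, l)) :
  smooth_on U A -> smooth_on U (fun x => (A x)^T).
Proof.
move=> sA; apply: smooth_mx => // i j.
by apply: (eq_smooth oU _ (smooth_entry oU j i sA)) => x _; rewrite mxE.
Qed.

Lemma smooth_usubmx k k' l (A : V -> 'M[R]_(k + k', l)) :
  smooth_on U A -> smooth_on U (fun x => usubmx (A x)).
Proof.
move=> sA; apply: smooth_mx => // i j.
by apply: (eq_smooth oU _ (smooth_entry oU (lshift k' i) j sA)) => x _; rewrite mxE.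
Qed.

Lemma smooth_dsubmx k k' l (A : V -> 'M[R]_(k + k', l)) :
  smooth_on U A -> smooth_on U (fun x => dsubmx (A x)).
Proof.
move=> sA; apply: smooth_mx => // i j.
by apply: (eq_smooth oU _ (smooth_entry oU (rshift k i) j sA)) => x _; rewrite mxE.
Qed.

Lemma smooth_lsubmx k l l' (A : V -> 'M[R]_(k, l + l')) :
  smooth_on U A -> smooth_on U (fun x => lsubmx (A x)).
Proof.
move=> sA; apply: smooth_mx => // i j.
by apply: (eq_smooth oU _ (smooth_entry oU i (lshift l' j) sA)) => x _; rewrite mxE.
Qed.

Lemma smooth_rsubmx k l l' (A : V -> 'M[R]_(k, l + l')) :
  smooth_on U A -> smooth_on U (fun x => rsubmx (A x)).
Proof.
move=> sA; apply: smooth_mx => // i j.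
by apply: (eq_smooth oU _ (smooth_entry oU i (rshift l j) sA)) => x _; rewrite mxE.
Qed.

Lemma smooth_scalar_mx k (f : V -> R) :
  smooth_on U f -> smooth_on U (fun x => (f x)%:M : 'M[R]_k).
Proof.
move=> sf; apply: (eq_smooth oU _ (smooth_scale sf (smooth_cst oU (1%:M : 'M[R]_k)))).
by move=> x _; rewrite scale_scalar_mx mulr1.
Qed.

Lemma smooth_col_mx k k' l (A : V -> 'M[R]_(k, l)) (A' : V -> 'M[R]_(k', l)) :
  smooth_on U A -> smooth_on U A' -> smooth_on U (fun x => col_mx (A x) (A' x)).
Proof.
move=> sA sA'; apply: smooth_mx => // i j; case: (splitP i) => i' ii'.
  apply: (eq_smooth oU _ (smooth_entry oU i' j sA)) => x _.
  by rewrite (_ : i = lshift k' i') ?col_mxEu//; exact: val_inj.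
apply: (eq_smooth oU _ (smooth_entry oU i' j sA')) => x _.
by rewrite (_ : i = rshift k i') ?col_mxEd//; exact: val_inj.
Qed.

Lemma smooth_row_mx k l l' (A : V -> 'M[R]_(k, l)) (A' : V -> 'M[R]_(k, l')) :
  smooth_on U A -> smooth_on U A' -> smooth_on U (fun x => row_mx (A x) (A' x)).
Proof.
move=> sA sA'.
apply: (eq_smooth oU _ (smooth_tr (smooth_col_mx (smooth_tr sA) (smooth_tr sA')))).
by move=> x _; rewrite tr_col_mx !trmxK.
Qed.

Lemma smooth_block_mx k k' l l' (A : V -> 'M[R]_(k, l)) (A1 : V -> 'M[R]_(k, l'))
    (A2 : V -> 'M[R]_(k', l)) (A3 : V -> 'M[R]_(k', l')) :
  smooth_on U A -> smooth_on U A1 -> smooth_on U A2 -> smooth_on U A3 ->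
  smooth_on U (fun x => block_mx (A x) (A1 x) (A2 x) (A3 x)).
Proof.
by move=> s s1 s2 s3; apply: smooth_col_mx; apply: smooth_row_mx.
Qed.

Lemma smooth_dot k (f g : V -> 'cV[R]_k) :
  smooth_on U f -> smooth_on U g -> smooth_on U (fun x => dot (f x) (g x)).
Proof.
by move=> sf sg; apply: smooth_entry => //; apply: smooth_mulmx => //; exact: smooth_tr.
Qed.

Lemma smooth_div (f g : V -> R) : smooth_on U f -> smooth_on U g ->
  (forall x, U x -> g x != 0) -> smooth_on U (fun x => f x / g x).
Proof. by move=> sf sg g0; apply: smoothM => //; exact: smoothV. Qed.

Context {n : nat}.
Notation N := (n + 1)%N.

Lemma smooth_refl (x : V -> 'cV[R]_n) :
  smooth_on U x -> smooth_on U (fun t => refl (x t)).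
Proof.
move=> sx.
have sq : smooth_on U (fun t => pole_vec (x t)).
  by apply: smooth_col_mx => //; exact: smooth_cst.
apply: smoothB => //; first exact: smooth_cst.
apply: smooth_scale; last by apply: smooth_mulmx => //; exact: smooth_tr.
apply: smooth_div; [exact: smooth_cst| |by move=> t _; exact: dot1_neq0].
by apply: smoothD => //; [exact: smooth_cst|exact: smooth_dot].
Qed.

Lemma smooth_dg (h : V -> 'M[R]_N) :
  smooth_on U h -> smooth_on U (fun t => dg (h t)).
Proof. by move=> sh; apply: smooth_block_mx => //; exact: smooth_cst. Qed.

Lemma smooth_kap (s d : V -> R) : smooth_on U s -> smooth_on U d ->
  (forall x, U x -> s x != 0) -> smooth_on U (fun t => kap (s t) (d t)).
Proof.
move=> ss sd s0; apply: smooth_div.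
- by do 2![apply: smoothD => //]; [exact: smoothX|exact: smooth_cst].
- by apply: smoothM => //; exact: smooth_cst.
- by move=> x Ux; rewrite mulf_neq0// s0.
Qed.

Lemma smooth_sig (s d : V -> R) : smooth_on U s -> smooth_on U d ->
  (forall x, U x -> s x != 0) -> smooth_on U (fun t => sig (s t) (d t)).
Proof.
move=> ss sd s0; apply: smooth_div.
- by apply: smoothD => //; apply: smoothB => //; [exact: smoothX|exact: smooth_cst].
- by apply: smoothM => //; exact: smooth_cst.
- by move=> x Ux; rewrite mulf_neq0// s0.
Qed.

Lemma smooth_Tmx (p v : V -> 'cV[R]_N) (s : V -> R) :
  smooth_on U p -> smooth_on U v -> smooth_on U s ->
  (forall x, U x -> s x != 0) ->
  smooth_on U (fun t => Tmx (p t) (v t) (s t)).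
Proof.
move=> sp sv ss s0.
have sV : smooth_on U (fun t => (s t)^-1) by exact: smoothV.
have svv := smooth_dot sv sv.
have svN := smoothN oU svv.
have so u w : smooth_on U u -> smooth_on U w ->
    smooth_on U (fun t => u t *m (w t : 'cV[R]_N)^T : 'M[R]_N).
  by move=> su sw; apply: smooth_mulmx => //; exact: smooth_tr.
apply: smooth_block_mx.
- by apply: smooth_scalar_mx; exact: smooth_kap.
- by apply/smooth_tr/smoothB => //; apply: smooth_scale => //; exact: smooth_sig.
- by apply: smoothB => //; apply: smooth_scale => //; exact: smooth_sig.
- apply: smoothD => //; last by apply: smooth_scale => //; exact: so.
  apply: smoothB => //; last exact: so.
  apply: smoothD => //; first exact: smooth_cst.
  apply: smooth_scale; last exact: so.
  by apply: smoothB => //; [exact: smooth_kap|exact: smooth_cst].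
Qed.

Lemma smooth_Cmx (s : V -> R) (y : V -> 'cV[R]_n) :
  smooth_on U s -> smooth_on U y -> (forall x, U x -> s x != 0) ->
  smooth_on U (fun t => Cmx (s t) (y t)).
Proof.
move=> ss sy s0.
apply: (eq_smooth oU _ (@smooth_Tmx (fun=> p0) (fun t => col_mx (y t) 0) s _ _ ss s0)).
- by move=> t Ut; rewrite -Cmx_Tmx// s0.
- exact: smooth_cst.
- by apply: smooth_col_mx => //; exact: smooth_cst.
Qed.

Lemma smooth_stereo_inv (x : V -> 'cV[R]_n) :
  smooth_on U x -> smooth_on U (fun t => stereo_inv (x t)).
Proof.
move=> sx; apply: (eq_smooth oU _ (smooth_mulmx (smooth_refl sx) (smooth_cst oU p0))).
by move=> t _; rewrite refl_p0.
Qed.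

Lemma smooth_sfac (g : V -> 'M[R]_(1 + N)) :
  smooth_on U g -> smooth_on U (fun t => sfac (g t)).
Proof.
move=> sg; apply: smoothD => //; apply: smooth_entry => //.
  by apply/smooth_lsubmx/smooth_usubmx.
by apply/smooth_dsubmx/smooth_lsubmx/smooth_dsubmx.
Qed.

Lemma smooth_yfac (g : V -> 'M[R]_(1 + N)) :
  smooth_on U g -> smooth_on U (fun t => yfac (g t)).
Proof.
by move=> sg; apply: smoothN => //; apply/smooth_usubmx/smooth_lsubmx/smooth_dsubmx.
Qed.

Lemma smooth_bfac (g : V -> 'M[R]_(1 + N)) : smooth_on U g ->
  (forall x, U x -> sfac (g x) != 0) -> smooth_on U (fun t => bfac (g t)).
Proof.
move=> sg g0.
have sV : smooth_on U (fun t => (sfac (g t))^-1).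
  by apply: smoothV => //; exact: smooth_sfac.
apply/smooth_rsubmx/smooth_dsubmx/smooth_mulmx => //; apply: smooth_Cmx => //.
  by apply: smoothN => //; apply: smooth_scale => //; exact: smooth_yfac.
by move=> x Ux; rewrite invr_eq0 g0.
Qed.

Lemma smooth_coc (z : V -> Zamb R n) : smooth_on U z ->
  (forall x, U x -> (z x).2 != 0) ->
  (forall x, U x -> sfac (Tmx (z x).1.1 (z x).1.2 (z x).2) != 0) ->
  smooth_on U (fun t => coc (z t)).
Proof.
move=> sz z0 f0; apply: smooth_bfac => //; apply: smooth_Tmx => //.
- by do 2![apply: smooth_fst => //].
- by apply: smooth_snd => //; exact: smooth_fst.
- exact: smooth_snd.
Qed.

End SmoothMatrices.

(** * The identity component *)

Section ConnectedComponents.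
Context {R : realType}.

Lemma connected_component_image (T U : topologicalType) (f : T -> U)
    (A : set T) (A' : set U) a b :
  (forall x, A x -> {for x, continuous f}) -> (forall x, A x -> A' (f x)) ->
  connected_component A a b -> connected_component A' (f a) (f b).
Proof.
move=> cf fA [D [Da DA cD] Db]; exists (f @` D); last by exists b.
split; [by exists a|by move=> _ [x /DA/fA A'fx <-]|].
apply: connected_continuous_connected => //.
by apply: continuous_in_subspaceT => x /set_mem/DA/cf.
Qed.

Lemma connected_component_path (T : topologicalType) (S : set T) (c : R -> T) :
  (forall t, 0 <= t <= 1 -> {for t, continuous c}) ->
  (forall t, 0 <= t <= 1 -> S (c t)) -> connected_component S (c 0) (c 1).
Proof.
move=> cc cS; apply: (@connected_component_image _ _ c `[0, 1]).
- by move=> t; rewrite /= in_itv; exact: cc.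
- by move=> t; rewrite /= in_itv; exact: cS.
exists `[0, 1]%classic; last by rewrite /= in_itv /= ler01 lexx.
by split=> //; [rewrite /= in_itv /= ler01 lexx|exact: segment_connected].
Qed.

Lemma open_smooth_neq0 (V : normedModType R) (U : set V) (f : V -> R) :
  open U -> smooth_on U f -> open [set x | U x /\ f x != 0].
Proof.
move=> oU sf; rewrite openE => x [Ux fx].
have cx := smooth_continuous sf Ux.
have nU : \forall y \near x, U y by exact: (open_nbhs_nbhs (conj oU Ux)).
have nf : \forall y \near x, f y != 0 by exact: (cvgr_neq0 _ cx fx).
by apply: filterS2 nU nf => y Uy fy.
Qed.

Lemma open_smooth_gt0 (V : normedModType R) (U : set V) (f : V -> R) :
  open U -> smooth_on U f -> open [set x | U x /\ 0 < f x].
Proof.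
move=> oU sf; rewrite openE => x [Ux fx].
have cx := smooth_continuous sf Ux.
have nU : \forall y \near x, U y by exact: (open_nbhs_nbhs (conj oU Ux)).
have nf : \forall y \near x, 0 < f y by apply: (cvgr_gt (f x)) => //; exact: cx.
by apply: filterS2 nU nf => y Uy fy.
Qed.

Lemma smoothT_continuous (V W : normedModType R) (f : V -> W) :
  smooth_on setT f -> continuous f.
Proof. by move=> sf x; exact: smooth_continuous sf I. Qed.

Lemma mulmx_continuous k l m (A : 'M[R]_(k, l)) :
  continuous (fun X : 'M[R]_(l, m) => A *m X).
Proof.
apply: smoothT_continuous; apply: smooth_mulmx => //; [exact: smooth_cst|exact: smooth_id].
Qed.

(** Translating a connected set through 1 and [b] by [a] gives one through [a] and
[a *m b]. *)
Lemma component_mulmx k (S : set 'M[R]_k) (a b : 'M[R]_k) :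
  (forall a b, S a -> S b -> S (a *m b)) ->
  connected_component S 1%:M a -> connected_component S 1%:M b ->
  connected_component S 1%:M (a *m b).
Proof.
move=> SM Sa Sb; apply: (connected_component_trans Sa); rewrite -{1}[a]mulmx1.
apply: (@connected_component_image _ _ (mulmx a) S S) Sb => x Sx.
  exact: mulmx_continuous.
by apply: SM => //; exact: connected_component_sub Sa.
Qed.

Section Sphere.
Context {n : nat}.
Notation N := (n + 1)%N.

Lemma smooth_line (W : normedModType R) (w w' : W) :
  smooth_on setT (fun t : R => w + t *: (w' - w)).
Proof.
apply: smoothD => //; first exact: smooth_cst.
apply: (@smooth_linear _ _ _ openT _ _ (fun t : R => t) (fun t => t *: (w' - w))).
- by move=> a u v; rewrite scalerDl scalerA.
- exact: scalel_continuous.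
- exact: smooth_id.
Qed.

Lemma SO_component_refl (x x' : 'cV[R]_n) :
  connected_component (SO N) 1%:M (refl x *m refl x').
Proof.
apply: connected_component_sym.
pose c (t : R) := refl (x + t *: (x' - x)) *m refl x'.
have -> : refl x *m refl x' = c 0 by rewrite /c scale0r addr0.
have -> : 1%:M = c 1 by rewrite /c scale1r addrC subrK refl_sq.
apply: connected_component_path => t _; last exact: SO_refl.
apply: (@smoothT_continuous _ _ c); apply: smooth_mulmx => //; last exact: smooth_cst.
by apply: smooth_refl => //; exact: smooth_line.
Qed.

(** The image of [p] under [refl x] is in the range of stereographic projection
unless [p = stereo_inv x]; two choices of [x] suffice to avoid that. *)
Lemma sphere_refl (p : 'cV[R]_N) : (0 < n)%N -> sphere p ->
  exists x x', refl x *m refl x' *m p0 = p.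
Proof.
move=> n0 Sp; have [x xp] : exists x, stereo_inv x <> p.
  have [E|] := pselect (stereo_inv 0 = p); last by exists 0.
  exists (const_mx 1); rewrite -E => /(congr1 (@stereo R n)).
  rewrite !stereo_invK => /matrixP/(_ (Ordinal n0) 0); rewrite !mxE.
  by move/eqP; rewrite oner_eq0.
have Sq : sphere (refl x *m p) by rewrite /sphere/= dot_refl.
exists x, (stereo (refl x *m p)); rewrite -mulmxA refl_p0 stereoK ?reflK//.
by move=> E; apply: xp; rewrite -refl_p0 -E reflK.
Qed.

Lemma SO_transitive (p : 'cV[R]_N) : (0 < n)%N -> sphere p ->
  exists2 h, SO N h & h *m p0 = p.
Proof.
move=> n0 Sp; have [x [x' E]] := sphere_refl n0 Sp.
by exists (refl x *m refl x') => //; exact: SO_refl.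
Qed.

(** The transpose also fixes the pole, so both the last column and the last row
are those of the identity. *)
Lemma SO_fix_p0 (h : 'M[R]_N) : SO N h -> h *m p0 = p0 ->
  exists2 L, SO n L & h = block_mx L 0 0 1%:M.
Proof.
move=> Sh hp; have hp' : h^T *m p0 = p0 by rewrite -{1}hp SO_trK.
move: Sh hp'; rewrite -[h]submxK tr_block_mx => -[].
set L := ulsubmx h; set u := ursubmx h; set w := dlsubmx h; set a := drsubmx h.
move=> ho hd; move: hp; rewrite -[h]submxK -/L -/u -/w -/a /p0 !mul_block_col.
rewrite !mulmx0 !mulmx1 !add0r => /eq_col_mx[u0 a1] /eq_col_mx[w0 _].
have {}w0 : w = 0 by rewrite -[w]trmxK w0 trmx0.
exists L; last by rewrite u0 a1 w0.
move: ho hd; rewrite u0 w0 a1 det_ublock det1 mulr1 tr_block_mx mulmx_block => ho hd.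
split=> //; move: ho; rewrite !(mulmx0, mul0mx, trmx0, addr0) -[1%:M in RHS]submxK.
by move=> /eq_block_mx[-> _ _ _]; apply/matrixP => i j; rewrite !mxE (inj_eq (@lshift_inj _ _)).
Qed.

End Sphere.

(** Induction on [k]: up to a product of two reflections, [h] fixes the pole and
is a rotation of one dimension less.  The sizes 0 and 1, where the
sphere is too small for [sphere_refl], are trivial groups. *)
Lemma SO_connected k (h : 'M[R]_k) : SO k h -> connected_component (SO k) 1%:M h.
Proof.
elim: k h => [|[|k] IHk] h Sh.
- have -> : h = 1%:M by apply/matrixP; case.
  by apply: connected_component_refl; exact: SO_id.
- have -> : h = 1%:M.
    by case: Sh => _; rewrite det_mx11 {2}[h]mx11_scalar => ->.
  by apply: connected_component_refl; exact: SO_id.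
move: h Sh; rewrite -(addn1 k.+1) => h Sh.
have Sp : sphere (h *m p0) by rewrite /sphere/= dot_SO// dot_p0.
have [x [x' E]] := sphere_refl (ltn0Sn k) Sp.
have Sr := SO_refl x x'.
have Sh' : SO (k.+1 + 1) ((refl x *m refl x')^T *m h) by apply: SO_mul => //; exact: SO_tr.
have [|L SL hE] := SO_fix_p0 Sh'; first by rewrite -mulmxA -E SO_trK.
have -> : h = (refl x *m refl x') *m block_mx L 0 0 1%:M by rewrite -hE SO_Ktr.
apply: component_mulmx; [exact: SO_mul|exact: SO_component_refl|].
rewrite [1%:M in X in connected_component _ X]scalar_mx_block.
pose f (M : 'M[R]_k.+1) : 'M[R]_(k.+1 + 1) := block_mx M 0 0 1%:M.
apply: (@connected_component_image _ _ f (SO k.+1)) (IHk _ SL) => M [Mo Md].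
  apply: (@smoothT_continuous _ _ f).
  by apply: smooth_block_mx => //; [exact: smooth_id| | |]; exact: smooth_cst.
split; last by rewrite det_ublock Md det1 mulr1.
rewrite tr_block_mx mulmx_block !(mulmx0, mul0mx, trmx0, addr0, add0r, trmx1, mulmx1).
by rewrite Mo -scalar_mx_block.
Qed.

End ConnectedComponents.

Section LorentzGroup.
Context {R : realType} {n : nat}.
Notation N := (n + 1)%N.
Implicit Types (y : 'cV[R]_n) (s : R) (h : 'M[R]_N) (g b c : 'M[R]_(1 + N)).

Lemma SO1_mul g1 g2 : SO1 g1 -> SO1 g2 -> SO1 (g1 *m g2).
Proof.
move=> [h1 d1] [h2 d2]; split; last by rewrite det_mulmx d1 d2 mulr1.
by rewrite trmx_mul mulmxA -(mulmxA g2^T g1^T) -(mulmxA g2^T _ g1) h1.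
Qed.

Lemma G_dg h : SO N h -> G (dg h).
Proof.
move=> Sh; rewrite /G -dg1.
apply: (@connected_component_image _ _ (@dg R n) (SO N)) (SO_connected Sh) => M SM.
  apply: (@smoothT_continuous _ _ _ (@dg R n)).
  by apply: smooth_dg => //; exact: smooth_id.
exact: dg_SO1.
Qed.

Lemma G_Cmx s y : 0 < s -> G (Cmx s y).
Proof.
move=> s0; pose c t := Cmx (1 + t *: (s - 1 : R)) (0 + t *: (y - 0)).
have -> : Cmx s y = c 1 by rewrite /c !scale1r add0r subr0 addrC subrK.
have -> : G = connected_component (@SO1 R n) (c 0) by rewrite /c !scale0r !addr0 Cmx1.
pose u (t : R) : R := 1 + t *: (s - 1).
have u0 t : 0 <= t <= 1 -> 0 < u t.
  move=> /andP[t0 t1]; rewrite /u /= /GRing.scale/=.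
  have [->|t0'] := eqVneq t 0; first by rewrite mul0r addr0.
  have -> : 1 + t * (s - 1) = (1 - t) + t * s by ring.
  by rewrite ltr_wpDl ?subr_ge0// mulr_gt0// lt_def t0' t0.
apply: connected_component_path => t /u0 ut; last by apply/C_SO1/C_Cmx.
have su : smooth_on setT u by exact: smooth_line.
have oU := open_smooth_neq0 openT su.
apply: (smooth_continuous (U := [set t | setT t /\ u t != 0])); last by split; rewrite ?gt_eqF.
apply: smooth_Cmx => //; last by move=> ? [].
  apply: smoothD => //; first exact: smooth_cst.
  by apply: smoothM => //; [exact: smooth_id|exact: smooth_cst].
apply: smoothD => //; first exact: smooth_cst.
by apply: smooth_scale => //; [exact: smooth_id|exact: smooth_cst].
Qed.

Lemma SO1_col g : SO1 g ->
  ulsubmx g 0 0 ^+ 2 = 1 + dot (dlsubmx g) (dlsubmx g).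
Proof.
move=> [/(congr1 (fun M => ulsubmx M 0 0)) + _].
rewrite -{1 2}[g]submxK tr_block_mx /lorentz !mulmx_block !block_mxKul.
rewrite !(mulmx0, mul0mx, addr0, add0r, mulmx1) mulmxN mulNmx mulmx1.
rewrite {1 2}[ulsubmx g]mx11_scalar tr_scalar_mx -scalar_mxM dotE !mxE !eqxx !mulr1n.
by move=> /(canRL (subrK _)) <-.
Qed.

(** G is connected and contains 1, and by [SO1_col] the corner cannot vanish on it. *)
Lemma G_gt0 g : G g -> 0 < ulsubmx g 0 0.
Proof.
move=> [A [A1 AS cA] Ag]; rewrite ltNge; apply/negP => g0.
pose f (X : 'M[R]_(1 + N)) : R := ulsubmx X 0 0.
have cf : connected (f @` A).
  apply: connected_continuous_connected => //.
  apply: continuous_subspaceT; apply: (@smoothT_continuous _ _ _ f).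
  apply: smooth_entry => //; apply: smooth_lsubmx => //; apply: smooth_usubmx => //.
  exact: smooth_id.
have f1 : f 1%:M = 1 by rewrite /f !mxE.
have : (f @` A) 0.
  move/connected_intervalP: cf => /(_ (f g) 1); apply.
  - by exists g.
  - by exists 1%:M.
  - by rewrite ler01 andbT.
move=> [X /AS/SO1_col]; rewrite -/(f X) => + fX; rewrite fX expr0n /= => /eqP.
by rewrite eq_sym (negbTE (dot1_neq0 _)).
Qed.

(** The Lorentz condition, paired with the first column, makes the first row
trivial too. *)
Lemma SO1_fix g : SO1 g -> ulsubmx g = 1%:M -> dlsubmx g = 0 ->
  exists2 h, SO N h & g = dg h.
Proof.
move=> [go gd] g1 g0; move: go gd; rewrite -[g]submxK g1 g0.
set r := ursubmx g; set h := drsubmx g; rewrite tr_block_mx /lorentz !mulmx_block.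
rewrite !(mulmx0, mul0mx, addr0, add0r, mulmx1, mul1mx, trmx1, trmx0).
move=> /eq_block_mx[_ r0 _]; rewrite r0 trmx0 mul0mx add0r mulmxN mulNmx mulmx1.
move=> /oppr_inj ho; rewrite det_lblock det1 mul1r => hd.
by exists h.
Qed.

(** The C-factor is the element of C with the same first column [(a, u, b)] as
[g], namely [Cmx (a + b) (- u)]; it exists because [0 < a + b], which follows
from [a ^+ 2 = 1 + |u|^2 + b ^+ 2] and [0 < a]. *)
Lemma SO1_CB g : SO1 g -> 0 < ulsubmx g 0 0 ->
  exists s y h, [/\ 0 < s, SO N h & g = Cmx s y *m dg h].
Proof.
move=> Sg; have := SO1_col Sg.
set a := ulsubmx g 0 0; rewrite -[dlsubmx g]vsubmxK [dsubmx (dlsubmx g)]mx11_scalar.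
set u := usubmx _; set b := dsubmx _ 0 0; rewrite dot_col dot_scalar => ab a0.
have s0 : 0 < a + b.
  rewrite -(pmulr_lgt0 _ (_ : 0 < a)) //; have := dot_ge0 u; nra.
pose c := Cmx (a + b) (- u).
have Cc : C c by exact: C_Cmx.
have cE : c *m col_mx 1%:M 0 = g *m col_mx 1%:M 0 :> 'cV_(1 + N).
  rewrite /c /Cmx -[in RHS](submxK g) !mul_block_col !mulmx0 !addr0 !mulmx1.
  rewrite [ulsubmx g]mx11_scalar -/a -[dlsubmx g]vsubmxK [dsubmx (dlsubmx g)]mx11_scalar.
  rewrite -/u -/b opprK !dotL opprK.
  have uu : dot u u = a ^+ 2 - 1 - b * b by rewrite ab; ring.
  rewrite uu; congr col_mx; first by congr (_%:M); field; rewrite gt_eqF.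
  by congr col_mx; congr (_%:M); field; rewrite gt_eqF.
have Sc' : SO1 (invmx c *m g) by apply: SO1_mul => //; exact/C_SO1/C_invmx.
have c'E : invmx c *m g *m col_mx 1%:M 0 = col_mx 1%:M 0 :> 'cV_(1 + N).
  by rewrite -mulmxA -cE mulKmx// C_unit.
have [||h Sh hE] := SO1_fix Sc'.
- move: c'E; rewrite -{1}[invmx c *m g]submxK mul_block_col.
  by rewrite !mulmx0 !addr0 !mulmx1 => /eq_col_mx[].
- move: c'E; rewrite -{1}[invmx c *m g]submxK mul_block_col.
  by rewrite !mulmx0 !addr0 !mulmx1 => /eq_col_mx[].
by exists (a + b), (- u), h; split=> //; rewrite -hE mulKVmx// C_unit.
Qed.

(** The decomposition in the other order, obtained from that of the inverse. *)
Lemma G_BC g : G g -> exists s y h, [/\ 0 < s, SO N h & g = dg h *m Cmx s y].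
Proof.
move=> Gg; have g0 := G_gt0 Gg; have Sg : SO1 g by exact: connected_component_sub Gg.
have := Sg; case=> go gd.
pose L := lorentz R n; pose g' := L *m g^T *m L.
have LL : L *m L = 1%:M := lorentz_sq.
have g'g : g' *m g = 1%:M by rewrite /g' -!mulmxA (mulmxA g^T) go.
have gg' := mulmx1C g'g.
have Lt : L^T = L by rewrite /L /lorentz tr_block_mx !trmx0 trmx1 linearN /= trmx1.
have Sg' : SO1 g'.
  split; last first.
    by have := congr1 determinant g'g; rewrite det_mulmx gd mulr1 det1.
  rewrite -/L /g' !trmx_mul trmxK Lt -!mulmxA (mulmxA L L) LL mul1mx.
  by rewrite (mulmxA L g^T) -/g' gg' mulmx1.
have g'0 : 0 < ulsubmx g' 0 0.
  suff -> : ulsubmx g' = ulsubmx g by [].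
  rewrite /g' /L /lorentz -{1}[g]submxK tr_block_mx !mulmx_block block_mxKul.
  rewrite !(mulmx0, mul0mx, addr0, add0r, mulmx1, mul1mx).
  by rewrite [ulsubmx g]mx11_scalar tr_scalar_mx.
have [s [y [h [s0 Sh g'E]]]] := SO1_CB Sg' g'0.
exists s^-1, (- (s^-1 *: y)), h^T; split; [by rewrite invr_gt0|exact: SO_tr|].
have : g' *m (dg h^T *m Cmx s^-1 (- (s^-1 *: y))) = 1%:M.
  rewrite g'E -mulmxA (mulmxA (dg h)) -dg_mul.
  by rewrite (mulmx1C (proj1 Sh)) dg1 mul1mx CmxV// gt_eqF.
by move=> /(congr1 (mulmx g)); rewrite mulmxA gg' mul1mx mulmx1.
Qed.

Lemma G_mul g c : G g -> G c -> G (g *m c).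
Proof. exact: component_mulmx SO1_mul. Qed.

End LorentzGroup.

(** * The quotient relations *)

Section Quotient.
Context {R : realType} {n : nat}.
Notation N := (n + 1)%N.
Implicit Types (y : 'cV[R]_n) (s : R) (h k : 'M[R]_N) (g b c : 'M[R]_(1 + N)).
Implicit Types (z : Zamb R n) (p v : 'cV[R]_N).
Notation e := (@p0 R n).

Lemma Cmx_inj s s' y y' : s != 0 -> s' != 0 -> Cmx s y = Cmx s' y' -> s = s' /\ y = y'.
Proof.
move=> s0 s'0 E; split.
  by have := congr1 (fun g => sfac (g *m dg 1%:M)) E; rewrite /= !sfacE.
by have := congr1 (fun g => yfac (g *m dg 1%:M)) E; rewrite /= !yfacE.
Qed.

Lemma BC_unique h h' c c' : SO N h -> SO N h' -> C c -> C c' ->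
  dg h *m c = dg h' *m c' -> h = h' /\ c = c'.
Proof.
move=> Sh Sh' Cc Cc' E.
have {}E : c *m invmx c' *m dg 1%:M = 1%:M *m dg (h^T *m h').
  rewrite dg1 mulmx1 mul1mx dg_mul; apply: (canLR (mulmxK (C_unit Cc'))).
  by rewrite -mulmxA -E mulmxA -dg_mul (proj1 Sh) dg1 mul1mx.
have [c1 h1] := Iwasawa_unique (C_mul Cc (C_invmx Cc')) C1 E.
split; first by rewrite -[LHS]mulmx1 h1 SO_Ktr.
by rewrite -[LHS](mulmxKV (C_unit Cc')) c1 mul1mx.
Qed.

Lemma bLE h c : SO N h -> C c -> bL (dg h *m c) = dg h.
Proof.
move=> Sh Cc; apply: xget_unique; first by split; [exact: B_dg|exists c].
move=> _ [[h' Sh' <-] [c' Cc' E]]; rewrite -/(dg h') in E *.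
by have [->] := BC_unique Sh Sh' Cc Cc' E.
Qed.

Lemma cRE h c : SO N h -> C c -> cR (dg h *m c) = c.
Proof.
move=> Sh Cc; apply: xget_unique; first by split=> //; exists (dg h) => //; exact: B_dg.
move=> c' [Cc' [_ [h' Sh' <-] E]]; rewrite -/(dg h') in E *.
by have [_ ->] := BC_unique Sh Sh' Cc Cc' E.
Qed.

Lemma cLE h c : SO N h -> C c -> cL (c *m dg h) = c.
Proof.
move=> Sh Cc; apply: xget_unique; first by split=> //; exists (dg h) => //; exact: B_dg.
move=> c' [Cc' [_ [h' Sh' <-] E]]; rewrite -/(dg h') in E *.
by have [->] := Iwasawa_unique Cc Cc' E.
Qed.

Lemma bRE h c : SO N h -> C c -> bR (c *m dg h) = dg h.
Proof.
move=> Sh Cc; apply: xget_unique; first by split; [exact: B_dg|exists c].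
move=> _ [[h' Sh' <-] [c' Cc' E]]; rewrite -/(dg h') in E *.
by have [_ ->] := Iwasawa_unique Cc Cc' E.
Qed.

Lemma Bmx_dg (L : 'M[R]_n) (u w : 'cV[R]_n) (a : R) :
  Bmx L u w a = dg (block_mx L u w^T a%:M).
Proof. by []. Qed.

Lemma B_dgE h : B (dg h) -> SO N h.
Proof. by move=> [h' Sh' /dg_inj <-]. Qed.

Lemma piZE h s y : SO N h -> 0 < s ->
  piZ (dg h *m Cmx s y) = (h *m e, h *m col_mx y 0, s).
Proof.
move=> Sh s0; apply: xget_unique.
  exists (ulsubmx h), (ursubmx h), (dlsubmx h)^T, (drsubmx h 0 0), s, y.
  have hE : h = block_mx (ulsubmx h) (ursubmx h) (dlsubmx h)^T^T (drsubmx h 0 0)%:M.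
    by rewrite trmxK -mx11_scalar submxK.
  rewrite Bmx_dg -hE; split=> //; first exact: B_dg.
  rewrite trmxK {1 2}hE trmxK /p0 !mul_block_col !mulmx0 !add0r !addr0 !mulmx1.
  by [].
move=> _ [L [u [w [a [s' [y' [/B_dgE Sh' s'0 E ->]]]]]]].
rewrite Bmx_dg in E; have [hE /Cmx_inj[||<- <-]] := BC_unique Sh Sh' (C_Cmx _ s0) (C_Cmx _ s'0) E.
- by rewrite gt_eqF.
- by rewrite gt_eqF.
by rewrite hE /p0 !mul_block_col !mulmx0 !add0r !addr0 !mulmx1.
Qed.

Lemma G_gpt h s y : SO N h -> 0 < s -> G (dg h *m Cmx s y).
Proof. by move=> Sh s0; apply: G_mul; [exact: G_dg|exact: G_Cmx]. Qed.

Lemma Zset_gpt h s y : SO N h -> 0 < s -> Zset (h *m e, h *m col_mx y 0, s).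
Proof.
move=> Sh s0; split=> //.
by split; rewrite /sphere /= dot_SO// ?dot_p0// dot_p0_col0.
Qed.

(** Any rotation that sends the pole to the base point of [z] is the rotation
factor of an element of G over [z]. *)
Lemma Zset_lift z h : Zset z -> SO N h -> h *m e = z.1.1 ->
  exists y, z = (h *m e, h *m col_mx y 0, z.2).
Proof.
case: z => -[p v] s /= [[/= Sp pv] s0] Sh hp; exists (usubmx (h^T *m v)).
rewrite -p0_tangent ?SO_Ktr ?hp//.
by rewrite -(dot_SO _ _ Sh) SO_Ktr// hp.
Qed.

(** Hence [c_L] depends only on the point of Z, and [b_R] is [coc z *m h]. *)
Lemma gpt_coc h s y : SO N h -> 0 < s ->
  exists2 c, C c & dg h *m Cmx s y = c *m dg (coc (h *m e, h *m col_mx y 0, s) *m h).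
Proof.
move=> Sh s0; have [c Cc E] := coc_Iwasawa (Zset_gpt y Sh s0).
exists c => //; rewrite Cmx_Tmx ?gt_eqF// Tmx_dg; last by case: Sh.
by rewrite dg_mul mulmxA -E.
Qed.

Lemma piZ_sB h s y (z := (h *m e, h *m col_mx y 0, s) : Zamb R n) :
  SO N h -> 0 < s -> piZ (sB (dg h *m Cmx s y)) = zinv z.
Proof.
move=> Sh s0; have [c Cc E] := gpt_coc y Sh s0.
have Sz := coc_SO (Zset_gpt y Sh s0).
have Szh : SO N (coc z *m h) by exact: SO_mul.
have Cs := C_Cmx y s0.
rewrite /sB (bLE Sh Cs) E (cLE Szh Cc).
have -> : invmx c *m dg h = dg (coc z *m h) *m Cmx s^-1 (- (s^-1 *: y)).
  rewrite -[RHS](mulKmx (C_unit Cc)); congr (_ *m _).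
  by rewrite mulmxA -E -mulmxA CmxV ?gt_eqF// mulmx1.
rewrite piZE ?invr_gt0// /zinv /= -!mulmxA; congr (_, _, _).
have -> : col_mx (- (s^-1 *: y)) 0 = - (s^-1 *: col_mx y 0) :> 'cV[R]_N.
  by rewrite scale_col_mx scaler0 opp_col_mx oppr0.
by rewrite !mulmxN -!scalemxAr.
Qed.

Lemma piZ_mB h1 h2 s1 s2 y1 y2
    (z1 := (h1 *m e, h1 *m col_mx y1 0, s1) : Zamb R n)
    (z2 := (h2 *m e, h2 *m col_mx y2 0, s2) : Zamb R n) :
  SO N h1 -> SO N h2 -> 0 < s1 -> 0 < s2 -> h2 = coc z1 *m h1 ->
  piZ (dg h1 *m Cmx s1 y1 *m Cmx s2 y2) = zmul z1 z2.
Proof.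
move=> Sh1 Sh2 s10 s20 hE; have S1 := coc_SO (Zset_gpt y1 Sh1 s10).
rewrite -mulmxA Cmx_mul ?gt_eqF// piZE ?mulr_gt0// /zmul; congr (_, _, _).
rewrite /= hE -mulmxA SO_trK// scalemxAr -mulmxDr; congr (_ *m _).
by rewrite scale_col_mx add_col_mx scaler0 addr0.
Qed.

Context (n0 : (0 < n)%N).

Lemma graph_stildeE z' z : graph_stilde (z', z) <-> Zset z /\ z' = zinv z.
Proof.
split.
  move=> [_ [g Gg <-] [<- <-]]; have [s [y [h [s0 Sh ->]]]] := G_BC Gg.
  by rewrite piZ_sB// piZE//; split=> //; exact: Zset_gpt.
move=> [Zz ->]; have [h Sh hp] := SO_transitive n0 (proj1 (proj1 Zz)).
have [y zE] := Zset_lift Zz Sh hp; have s0 : 0 < z.2 by case: Zz.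
exists (sB (dg h *m Cmx z.2 y), dg h *m Cmx z.2 y).
  by exists (dg h *m Cmx z.2 y) => //; exact: G_gpt.
by rewrite /= piZ_sB// piZE// -zE.
Qed.

(** For the converse, the second factor is lifted with the rotation
[coc z1 *m h1], which makes the two lifts composable in [G_B]. *)
Lemma graph_mtildeE z z1 z2 : graph_mtilde (z, z1, z2) <->
  composable Zset zl zr (z1, z2) /\ z = zmul z1 z2.
Proof.
split.
  move=> [_ [g1 [g2 [G1 G2 E ->]]] [<- <- <-]] /=.
  have [s1 [y1 [h1 [s10 Sh1 g1E]]]] := G_BC G1.
  have [s2 [y2 [h2 [s20 Sh2 g2E]]]] := G_BC G2.
  have [c Cc gcE] := gpt_coc y1 Sh1 s10.
  have Sz1 := coc_SO (Zset_gpt y1 Sh1 s10).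
  have Cs2 := C_Cmx y2 s20.
  have Szh : SO N (coc (h1 *m e, h1 *m col_mx y1 0, s1) *m h1) by exact: SO_mul.
  move: E; rewrite g1E gcE (bRE Szh Cc) g2E (bLE Sh2 Cs2) => /dg_inj hE.
  rewrite -gcE (cRE Sh2 Cs2) (piZ_mB y2 Sh1 Sh2 s10 s20 (esym hE)) !piZE//; split=> //.
  by apply/composableE; split; [exact: Zset_gpt|exact: Zset_gpt|rewrite /= -hE -mulmxA].
move=> [/composableE[Z1 Z2 E] ->].
have [h1 Sh1 hp1] := SO_transitive n0 (proj1 (proj1 Z1)).
have [y1 z1E] := Zset_lift Z1 Sh1 hp1; have s10 : 0 < z1.2 by case: Z1.
have Szh : SO N (coc z1 *m h1) by apply: SO_mul => //; exact: coc_SO.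
have [|y2 z2E] := Zset_lift Z2 Szh; first by rewrite -mulmxA hp1.
have s20 : 0 < z2.2 by case: Z2.
have [c Cc gcE] := gpt_coc y1 Sh1 s10; rewrite -z1E in gcE.
have Cs2 := C_Cmx y2 s20.
exists (dg h1 *m Cmx z1.2 y1 *m Cmx z2.2 y2, dg h1 *m Cmx z1.2 y1,
  dg (coc z1 *m h1) *m Cmx z2.2 y2).
  exists (dg h1 *m Cmx z1.2 y1), (dg (coc z1 *m h1) *m Cmx z2.2 y2).
  split; [exact: G_gpt|exact: G_gpt| |].
    by rewrite gcE (bRE Szh Cc) (bLE Szh Cs2).
  by rewrite (cRE Szh Cs2).
have := @piZ_mB _ _ _ _ y1 y2 Sh1 Szh s10 s20; rewrite /= -z1E -z2E => /(_ erefl) ->.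
by rewrite !piZE// -z1E -z2E.
Qed.

Lemma EtildeE : @Etilde R n = Zunits.
Proof.
apply/seteqP; split=> [_ [_ [h Sh <-] <-]|_ [p Sp <-]].
  exists (h *m e); first by rewrite /sphere /= dot_SO// dot_p0.
  rewrite -/(dg h) -[dg h]mulmx1 -Cmx1 piZE//.
  by rewrite col_mx0 mulmx0.
have [h Sh hp] := SO_transitive n0 Sp.
exists (dg h); first exact: B_dg.
by rewrite -[dg h]mulmx1 -Cmx1 piZE// col_mx0 mulmx0 hp.
Qed.

Lemma eLE z : Zset z -> eL z = zl z.
Proof.
have gZ := @Z_groupoid R n => Zz.
have cE p : composable Zset zl zr ((p, 0, 1), z) <-> sphere p /\ p = z.1.1.
  split=> [/composableE[[[Sp _] _] _]|[Sp ->]].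
    by rewrite coc_unit mul1mx.
  apply/composableE; rewrite coc_unit mul1mx; split=> //.
  by apply: Zset_unit; case: Zz => -[].
apply: xget_unique.
  split; first by rewrite EtildeE; exact: (lproj_unit gZ).
  apply/graph_mtildeE; split; last by rewrite (mul_lunit gZ).
  by apply/cE; split=> //; case: Zz => -[].
by move=> e'; rewrite EtildeE => -[[p Sp <-] /graph_mtildeE[/cE[_ ->]]].
Qed.

Lemma eRE z : Zset z -> eR z = zr z.
Proof.
have gZ := @Z_groupoid R n => Zz.
have cE p : composable Zset zl zr (z, (p, 0, 1)) <-> sphere p /\ coc z *m z.1.1 = p.
  split=> [/composableE[_ [[Sp _] _]]//|[Sp E]].
  by apply/composableE; split=> //; exact: Zset_unit.
apply: xget_unique.
  split; first by rewrite EtildeE; exact: (rproj_unit gZ).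
  apply/graph_mtildeE; split; last by rewrite (mul_runit gZ).
  by apply/cE; split=> //; have [p Sp [<-]] := rproj_unit gZ Zz.
by move=> e'; rewrite EtildeE => -[[p Sp <-] /graph_mtildeE[/cE[_ <-]]].
Qed.

Lemma stildeE z : Zset z -> stilde z = zinv z.
Proof.
move=> Zz; apply: xget_unique; first exact/graph_stildeE.
by move=> z' /graph_stildeE[].
Qed.

Lemma composable_eLR z1 z2 : composable Zset (@eL R n) (@eR R n) (z1, z2) <->
  composable Zset zl zr (z1, z2).
Proof. by split=> -[/= Z1 Z2 E]; split=> //=; move: E; rewrite eRE// eLE. Qed.

Lemma mtildeE z1 z2 : composable Zset (@eL R n) (@eR R n) (z1, z2) ->
  mtilde z1 z2 = zmul z1 z2.
Proof.
move=> /composable_eLR Z12; apply: xget_unique; first exact/graph_mtildeE.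
by move=> z' /graph_mtildeE[].
Qed.

Lemma Z_groupoid_tilde :
  is_groupoid Zset Etilde (@eL R n) (@eR R n) (@stilde R n) (@mtilde R n).
Proof.
have gZ := @Z_groupoid R n; rewrite EtildeE.
have UZ := units_sub gZ.
have iZ := inv_closed gZ.
have mZ z1 z2 : composable Zset (@eL R n) (@eR R n) (z1, z2) ->
    [/\ Zset z1, Zset z2, composable Zset zl zr (z1, z2),
        mtilde z1 z2 = zmul z1 z2 & Zset (zmul z1 z2)].
  move=> c12; have c12' := (composable_eLR z1 z2).1 c12.
  split; [by case: c12|by case: c12|by []|exact: mtildeE|exact: (mul_closed gZ)].
have lc z : Zset z -> composable Zset (@eL R n) (@eR R n) (zl z, z).
  move=> Zz; have Zl := UZ _ (lproj_unit gZ Zz).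
  by split=> //=; rewrite eLE// eRE// (rproj_id gZ)//; exact: lproj_unit gZ _ Zz.
have rc z : Zset z -> composable Zset (@eL R n) (@eR R n) (z, zr z).
  move=> Zz; have Zr := UZ _ (rproj_unit gZ Zz).
  by split=> //=; rewrite eLE// eRE// (lproj_id gZ)//; exact: rproj_unit gZ _ Zz.
have ic z : Zset z -> composable Zset (@eL R n) (@eR R n) (z, zinv z).
  by move=> Zz; split=> //=; [exact: iZ|rewrite eRE// eLE ?(lproj_inv gZ)//; exact: iZ].
have ic' z : Zset z -> composable Zset (@eL R n) (@eR R n) (zinv z, z).
  by move=> Zz; split=> //=; [exact: iZ|rewrite eLE// eRE ?(rproj_inv gZ)//; exact: iZ].
split=> //.
- by move=> z Zz; rewrite eLE//; exact: (lproj_unit gZ).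
- by move=> z Zz; rewrite eRE//; exact: (rproj_unit gZ).
- by move=> z Ez; rewrite eLE ?(lproj_id gZ)//; exact: UZ.
- by move=> z Ez; rewrite eRE ?(rproj_id gZ)//; exact: UZ.
- by move=> z Zz; rewrite stildeE//; exact: iZ.
- by move=> x y /mZ[_ _ _ ->].
- by move=> x y /mZ[Zx _ c -> Zm]; rewrite !eLE// (lproj_mul gZ c).
- by move=> x y /mZ[_ Zy c -> Zm]; rewrite !eRE// (rproj_mul gZ c).
- move=> x y z /mZ[Zx Zy cxy -> Zxy] /mZ[_ Zz cyz -> Zyz].
  rewrite !mtildeE ?(mul_assoc gZ)//; apply/composable_eLR; split=> //=.
    by rewrite (lproj_mul gZ cyz); case: cxy.
  by rewrite (rproj_mul gZ cxy); case: cyz.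
- by move=> z Zz; rewrite eLE// mtildeE ?(mul_lunit gZ)//; exact: lc.
- by move=> z Zz; rewrite eRE// mtildeE ?(mul_runit gZ)//; exact: rc.
- by move=> z Zz; rewrite stildeE// eRE// eLE ?(lproj_inv gZ)//; exact: iZ.
- by move=> z Zz; rewrite stildeE// eLE// eRE ?(rproj_inv gZ)//; exact: iZ.
- by move=> z Zz; rewrite stildeE// eLE// mtildeE ?(mul_inv_r gZ)//; exact: ic.
- by move=> z Zz; rewrite stildeE// eRE// mtildeE ?(mul_inv_l gZ)//; exact: ic'.
Qed.

Lemma Cmx_dg k s y y' : SO N k -> 0 < s -> k *m e = e ->
  k *m col_mx y' 0 = col_mx y 0 -> Cmx s y *m dg k = dg k *m Cmx s y'.
Proof.
move=> Sk s0 ke ky; rewrite !Cmx_Tmx ?gt_eqF// Tmx_dg; last by case: Sk.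
by rewrite ke ky.
Qed.

Lemma SO_tangent k y : SO N k -> k *m e = e -> exists y', k *m col_mx y 0 = col_mx y' 0.
Proof.
move=> Sk ke; exists (usubmx (k *m col_mx y 0)); apply: p0_tangent.
by rewrite -{1}ke dot_SO// dot_p0_col0.
Qed.

Lemma SO_tr_p0 k : SO N k -> k *m e = e -> k^T *m e = e.
Proof. by move=> Sk ke; rewrite -{1}ke SO_trK. Qed.

Lemma dist_p0 p : dot p p = 1 -> dot p e = 1 -> p = e.
Proof.
move=> pp pe; apply/eqP; rewrite -subr_eq0; apply/eqP/dot_eq0.
by rewrite !dotL pp dot_p0 pe dotC pe; ring.
Qed.

(** If a rotation [k] normalizes C, then a conjugate [Tmx p v 1] with [v <> 0] is
in C, and it fixes the direction of the null vector [(1, - p0)], as all of C does.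
Comparing coordinates forces [p = k p0] to be the pole. *)
Lemma B0E b : B0 b <-> exists2 k, SO N k /\ k *m e = e & b = dg k.
Proof.
split=> [[[Gb nb] [k Sk bE]]|[k [Sk ke] ->]]; last first.
  split; last exact: B_dg; split; first exact: G_dg.
  apply/seteqP; split=> [_ [_ [s [y [s0 ->]]] <-]|_ [s [y [s0 ->]]]].
    have [y' yE] := SO_tangent y Sk ke.
    exists s, y'; split=> //; rewrite -(Cmx_dg Sk s0 ke yE) mulmxK//.
    by have [_] := dg_SO1 Sk; rewrite unitmxE => ->; rewrite unitr1.
  have [y' yE] := SO_tangent y (SO_tr Sk) (SO_tr_p0 Sk ke).
  exists (Cmx s y'); first exact: C_Cmx.
  rewrite -(@Cmx_dg k s y y')//; last by rewrite -yE SO_Ktr.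
  rewrite mulmxK//.
  by have [_] := dg_SO1 Sk; rewrite unitmxE => ->; rewrite unitr1.
exists k => //; split=> //; rewrite -/(dg k) in bE; subst b.
pose y : 'cV[R]_n := const_mx 1; pose v := k *m col_mx y 0; pose p := k *m e.
have vv : dot v v != 0.
  rewrite /v dot_SO// dot_col dot0l addr0; apply/eqP => /dot_eq0.
  by move=> /matrixP/(_ (Ordinal n0) 0); rewrite !mxE => /eqP; rewrite oner_eq0.
have pp : dot p p = 1 by rewrite /p dot_SO// dot_p0.
have pv : dot p v = 0 by rewrite /p /v dot_SO// dot_p0_col0.
have [s' [y' [s'0 E]]] : C (Tmx p v 1).
  rewrite -nb; exists (Cmx 1 y); first exact: C_Cmx.
  rewrite Cmx_Tmx ?oner_eq0// Tmx_dg; last by case: Sk.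
  rewrite mulmxK//.
  by have [_] := dg_SO1 Sk; rewrite unitmxE => ->; rewrite unitr1.
apply: dist_p0 => //; apply/eqP; rewrite -subr_eq0; apply/negP => /negP pe1.
have := congr1 (mulmx^~ (col_mx 1%:M (- e))) E.
rewrite Cmx_Tmx ?gt_eqF// !Tmx_act => /eq_col_mx[].
rewrite !dotL dot_p0 [dot (col_mx y' 0) e]dotC dot_p0_col0 => t1 t2.
have {}t1 := congr1 (fun M : 'M[R]_1 => M 0 0) t1.
move: t1; rewrite !mxE !eqxx !mulr1n => t1.
have := congr1 (dot p) t2; have := congr1 (dot v) t2.
rewrite !dotL pp pv [dot v p]dotC pv !(subrr, mul0r, subr0, mulr0).
move: t1 pe1 vv; rewrite /kap /sig.
move: (dot v v) (dot p e) (dot v e) (dot (col_mx y' 0) _) => d a b d'.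
have s'n0 : s' != 0 by rewrite gt_eqF.
rewrite (_ : _ + _ - s'^-1 * - 0 = s'^-1); last by field.
rewrite (_ : _ + s'^-1 * - 0 = 1 - s'^-1); last by field.
move=> t1 a1 d0.
have -> : 1 - s'^-1 = d * (a - 1) / 2 - b by rewrite -t1; field.
(* [q] is the coefficient of both [p] and [p0] in [t2]; pairing with [p] gives
[q (a - 1) = 0], and then pairing with [v] gives [(1 - a) d = 0] *)
set q := _ / 2 - b => tv tp.
have q0 : q = 0.
  apply/eqP; rewrite -(inj_eq (mulIf a1)) mul0r mulrBr mulr1 subr_eq0; apply/eqP.
  by apply: (addIr (- a)); rewrite -tp /q; field.
have /eqP := mulf_neq0 a1 d0; apply.
have -> : (a - 1) * d = 0 - (1 - a) * d - b + b by ring.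
by rewrite tv q0; ring.
Qed.

Lemma piZ_image : @piZ R n @` G = Zset.
Proof.
apply/seteqP; split=> [_ [g /G_BC[s [y [h [s0 Sh ->]]]] <-]|z Zz].
  by rewrite piZE//; exact: Zset_gpt.
have [h Sh hp] := SO_transitive n0 (proj1 (proj1 Zz)).
have [y zE] := Zset_lift Zz Sh hp; have s0 : 0 < z.2 by case: Zz.
exists (dg h *m Cmx z.2 y); first exact: G_gpt.
by rewrite piZE.
Qed.

Lemma piZ_fibers g g' : G g -> G g' ->
  (piZ g = piZ g' <-> exists2 b0, B0 b0 & g' = g *m b0).
Proof.
move=> /G_BC[s [y [h [s0 Sh ->]]]] /G_BC[s' [y' [h' [s'0 Sh' ->]]]].
rewrite !piZE//; split=> [[hp hv ss]|[_ /B0E[k [Sk ke] ->] E]].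
  have Sk : SO N (h^T *m h') by apply: SO_mul => //; exact: SO_tr.
  have ke : h^T *m h' *m e = e by rewrite -mulmxA -hp SO_trK.
  exists (dg (h^T *m h')); first by apply/B0E; exists (h^T *m h').
  rewrite -mulmxA (@Cmx_dg _ s y y')// -?mulmxA -?hv ?SO_trK//.
  by rewrite mulmxA -dg_mul SO_Ktr// ss.
have [y2 yE] := SO_tangent y (SO_tr Sk) (SO_tr_p0 Sk ke).
move: E; rewrite -mulmxA (@Cmx_dg k s y y2)//; last by rewrite -yE SO_Ktr.
rewrite mulmxA -dg_mul => E.
have Shk : SO N (h *m k) by exact: SO_mul.
have [hE /Cmx_inj[||sE y'E]] := BC_unique Sh' Shk (C_Cmx _ s'0) (C_Cmx _ s0) E.
- by rewrite gt_eqF.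
- by rewrite gt_eqF.
by rewrite hE sE y'E -!mulmxA ke -yE SO_Ktr.
Qed.

End Quotient.

(** * The differential structure *)

Section SmoothMaps.
Context {R : realType}.
Implicit Types (V W : normedModType R).

Lemma smooth_map_on V W (X U : set V) (f F : V -> W) : open U -> X `<=` U ->
  smooth_on U F -> (forall x, X x -> f x = F x) -> smooth_map X f.
Proof.
move=> oU XU sF fF x Xx; exists U, F; split=> //; first exact: XU.
by move=> y [Xy _]; exact: fF.
Qed.

(** Tangent vectors are velocities of curves, so a smooth map is a submersion when
curves in the target can be lifted through every point. *)
Lemma submersion_lift V W (X : set V) (Y : set W) (f : V -> W) :
  set_fun X Y f -> smooth_map X f ->
  (forall x c, X x -> smooth_curve_at X x c -> smooth_curve_at Y (f x) (f \o c)) ->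
  (forall x d, X x -> smooth_curve_at Y (f x) d ->
    exists2 c, smooth_curve_at X x c & {near (0 : R), f \o c =1 d}) ->
  submersion X Y f.
Proof.
move=> XY sf fc lift; split=> // x Xx; apply/seteqP; split=> [_ [c cx <-]|_ [d dx <-]].
  by exists (f \o c) => //; exact: fc.
have [c cx cd] := lift _ _ Xx dx; exists c => //.
by rewrite !derive1E; exact: near_eq_derive.
Qed.

End SmoothMaps.

Section SmoothGroupoid.
Context {R : realType} {n : nat}.
Notation N := (n + 1)%N.
Notation Zamb := (Zamb R n).
Notation e := (@p0 R n).
Implicit Types (V : normedModType R) (z : Zamb).

(** The open set where the denominators of [coc] do not vanish. *)
Definition coc_dom : set Zamb :=
  [set z | z.2 != 0 /\ sfac (Tmx z.1.1 z.1.2 z.2) != 0].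

Lemma Zset_coc_dom : Zset `<=` coc_dom.
Proof.
move=> z Zz; have z0 : 0 < z.2 by case: Zz.
split; first by rewrite gt_eqF.
by have [c [s [y [s0 ->]]] ->] := coc_Iwasawa Zz; rewrite sfacE gt_eqF.
Qed.

Section Rules.
Context {V : normedModType R} {U : set V} (oU : open U).

Lemma open_coc_dom (z : V -> Zamb) : smooth_on setT z -> open (z @^-1` coc_dom).
Proof.
move=> sz; have s2 : smooth_on setT (fun x => (z x).2) by exact: smooth_snd.
have o1 := open_smooth_neq0 openT s2.
have sz1 : smooth_on [set x | setT x /\ (z x).2 != 0] z.
  by apply: smooth_subset sz => x.
have s3 : smooth_on [set x | setT x /\ (z x).2 != 0]
    (fun x => sfac (Tmx (z x).1.1 (z x).1.2 (z x).2)).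
  apply: smooth_sfac => //; apply: smooth_Tmx => //.
  - by do 2![apply: smooth_fst => //].
  - by apply: smooth_snd => //; exact: smooth_fst.
  - exact: smooth_snd.
  - by move=> x [].
have := open_smooth_neq0 o1 s3.
by congr open; apply/seteqP; split=> [x [[_ ?] ?]|x [? ?]].
Qed.

Lemma smooth_zl (z : V -> Zamb) : smooth_on U z -> smooth_on U (fun x => zl (z x)).
Proof.
move=> sz; apply: smooth_pair => //; last exact: smooth_cst.
by apply: smooth_pair => //; [do 2![apply: smooth_fst => //]|exact: smooth_cst].
Qed.

Lemma smooth_zr (z : V -> Zamb) : smooth_on U z -> (forall x, U x -> coc_dom (z x)) ->
  smooth_on U (fun x => zr (z x)).
Proof.
move=> sz dz; apply: smooth_pair => //; last exact: smooth_cst.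
apply: smooth_pair => //; last exact: smooth_cst.
apply: smooth_mulmx => //; last by do 2![apply: smooth_fst => //].
by apply: smooth_coc => // x /dz[].
Qed.

Lemma smooth_zinv (z : V -> Zamb) : smooth_on U z -> (forall x, U x -> coc_dom (z x)) ->
  smooth_on U (fun x => zinv (z x)).
Proof.
move=> sz dz; have sc : smooth_on U (fun x => coc (z x)).
  by apply: smooth_coc => // x /dz[].
have sV : smooth_on U (fun x => (z x).2^-1).
  by apply: smoothV => //; [exact: smooth_snd|move=> x /dz[]].
apply: smooth_pair => //; apply: smooth_pair => //.
  by apply: smooth_mulmx => //; do 2![apply: smooth_fst => //].
apply: smoothN => //; apply: smooth_scale => //; apply: smooth_mulmx => //.
by apply: smooth_snd => //; exact: smooth_fst.
Qed.

Lemma smooth_zmul (z z' : V -> Zamb) : smooth_on U z -> smooth_on U z' ->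
  (forall x, U x -> coc_dom (z x)) -> smooth_on U (fun x => zmul (z x) (z' x)).
Proof.
move=> sz sz' dz; have sc : smooth_on U (fun x => coc (z x)).
  by apply: smooth_coc => // x /dz[].
have s2 := smooth_snd oU sz'.
apply: smooth_pair => //; last by apply: smoothM => //; exact: smooth_snd.
apply: smooth_pair => //; first by do 2![apply: smooth_fst => //].
apply: smoothD => //.
  by apply: smooth_scale => //; apply: smooth_snd => //; exact: smooth_fst.
apply: smooth_mulmx => //; first exact: smooth_tr.
by apply: smooth_snd => //; exact: smooth_fst.
Qed.

End Rules.

Context (n0 : (0 < n)%N).

Lemma smooth_map_zl (f : Zamb -> Zamb) :
  (forall z, Zset z -> f z = zl z) -> smooth_map Zset f.
Proof.
apply: (smooth_map_on openT) => //; apply: smooth_zl => //; exact: smooth_id.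
Qed.

Lemma coc_dom_open : open coc_dom.
Proof. by apply: open_coc_dom; exact: smooth_id. Qed.

Lemma smooth_map_eR : smooth_map Zset (@eR R n).
Proof.
apply: (smooth_map_on coc_dom_open Zset_coc_dom); last exact: eRE.
exact: (smooth_zr coc_dom_open (smooth_id coc_dom_open)).
Qed.

Lemma smooth_map_stilde : smooth_map Zset (@stilde R n).
Proof.
apply: (smooth_map_on coc_dom_open Zset_coc_dom); last exact: stildeE.
exact: (smooth_zinv coc_dom_open (smooth_id coc_dom_open)).
Qed.

Lemma smooth_map_mtilde :
  smooth_map (composable Zset (@eL R n) (@eR R n)) (fun xy => mtilde xy.1 xy.2).
Proof.
have s1 : smooth_on setT (fun xy : Zamb * Zamb => xy.1).
  by apply: smooth_fst => //; exact: smooth_id.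
have o1 := open_coc_dom s1.
apply: (@smooth_map_on _ _ _ _ _ _ (fun xy => zmul xy.1 xy.2) o1).
- by move=> [z1 z2] [Z1 _ _]; exact: Zset_coc_dom.
- apply: (smooth_zmul o1) => //.
    by apply: smooth_fst => //; exact: smooth_id.
  by apply: smooth_snd => //; exact: smooth_id.
- by move=> [z1 z2]; exact: mtildeE.
Qed.

(** The vector of [z] is projected to the moving tangent space. *)
Lemma curve_zl_lift z d : Zset z -> smooth_curve_at Zunits (zl z) d ->
  exists c, smooth_curve_at Zset z c /\
    exists U : set R, [/\ open U, U 0 & forall t, U t -> zl (c t) = d t].
Proof.
move=> Zz [d0 [U [oU U0 sd dE]]].
have sq : smooth_on U (fun t => (d t).1.1) by do 2![apply: smooth_fst => //].
pose v := z.1.2.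
exists (fun t => ((d t).1.1, v - dot v (d t).1.1 *: (d t).1.1, z.2)); split.
  split; last exists U.
    rewrite d0 /= /v dotC; case: Zz => -[_ ->] _; rewrite scale0r subr0.
    by case: (z) => -[].
  split=> //.
    apply: smooth_pair => //; last exact: smooth_cst.
    apply: smooth_pair => //; apply: smoothB => //; first exact: smooth_cst.
    by apply: smooth_scale => //; apply: smooth_dot => //; exact: smooth_cst.
  move=> t /dE[p Sp <-] /=; split; last by case: Zz.
  by split=> //=; rewrite !dotL Sp mulr1 dotC subrr.
by exists U; split=> // t /dE[p Sp <-].
Qed.

Lemma submersion_eL : submersion Zset Etilde (@eL R n).
Proof.
have gZ := @Z_groupoid R n; rewrite (EtildeE n0).
apply: submersion_lift.
- by move=> z Zz; rewrite eLE//; exact: (lproj_unit gZ).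
- by apply: smooth_map_zl; exact: eLE.
- move=> z c Zz [cz [U [oU U0 sc cZ]]]; split; first by rewrite /= cz.
  exists U; split=> //.
    apply: (eq_smooth oU _ (smooth_zl oU sc)) => t Ut /=.
    by rewrite eLE//; exact: cZ.
  by move=> t Ut; rewrite /= eLE; [exact/(lproj_unit gZ)/cZ| |exact: cZ].
- move=> z d Zz; rewrite eLE// => /(curve_zl_lift Zz)[c [cz [U [oU U0 cd]]]].
  exists c => //; case: cz => _ [U' [oU' U'0 _ cZ]].
  have nU := open_nbhs_nbhs (conj oU U0).
  apply: filterS2 nU (open_nbhs_nbhs (conj oU' U'0)) => t Ut U't.
  by rewrite /= eLE ?cd//; exact: cZ.
Qed.

(** [e_R] is [e_L] after the inverse map, so the lift through [zinv z] is carried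
back by [zinv]. *)
Lemma submersion_eR : submersion Zset Etilde (@eR R n).
Proof.
have gZ := @Z_groupoid R n; rewrite (EtildeE n0).
apply: submersion_lift.
- by move=> z Zz; rewrite eRE//; exact: (rproj_unit gZ).
- exact: smooth_map_eR.
- move=> z c Zz [cz [U [oU U0 sc cZ]]]; split; first by rewrite /= cz.
  exists U; split=> //.
    apply: (eq_smooth oU _ (smooth_zr oU sc _)) => t Ut /=; last exact/Zset_coc_dom/cZ.
    by rewrite eRE//; exact: cZ.
  by move=> t Ut; rewrite /= eRE; [exact/(rproj_unit gZ)/cZ| |exact: cZ].
- move=> z d Zz; rewrite eRE// -(lproj_inv gZ Zz) => dz.
  have Zi := Zset_zinv Zz.
  have [c [[cz [U' [oU' U'0 sc cZ]]] [U [oU U0 cd]]]] := curve_zl_lift Zi dz.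
  exists (fun t => zinv (c t)).
    split; first by rewrite cz zinvK.
    exists U'; split=> //; last by move=> t /cZ; exact: Zset_zinv.
    by apply: smooth_zinv => // t /cZ; exact: Zset_coc_dom.
  have nU := open_nbhs_nbhs (conj oU U0).
  apply: filterS2 nU (open_nbhs_nbhs (conj oU' U'0)) => t Ut U't.
  have Zc := cZ _ U't.
  by rewrite /= eRE ?(rproj_inv gZ Zc) ?cd//; exact: Zset_zinv.
Qed.

Notation coord := ('cV[R]_n * 'cV[R]_n * R)%type.
Implicit Types (ep : R) (q : coord).

(** Stereographic coordinates from [p0] for [ep = 1], from [- p0] for [ep = -1]. *)
Definition chart ep q : Zamb :=
  (ep *: stereo_inv q.1.1, ep *: (refl q.1.1 *m col_mx q.1.2 0), q.2).

Definition chart_inv ep z : coord :=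
  let x := stereo (ep *: z.1.1) in
  (x, usubmx (refl x *m (ep *: z.1.2)), z.2).

Definition chart_dom ep : set Zamb := [set z | 1 - ep * dsubmx z.1.1 0 0 != 0].

Lemma open_chart_dom ep : open (chart_dom ep).
Proof.
rewrite (_ : chart_dom ep = [set z | setT z /\ 1 - ep * dsubmx z.1.1 0 0 != 0]).
  apply: open_smooth_neq0 => //; apply: smoothB => //; first exact: smooth_cst.
  apply: smoothM => //; first exact: smooth_cst.
  apply: smooth_entry => //; apply: smooth_dsubmx => //.
  by do 2![apply: smooth_fst => //]; exact: smooth_id.
by apply/seteqP; split=> [z ?|z []].
Qed.

Lemma chart_domP ep z : ep * ep = 1 -> Zset z ->
  chart_dom ep z <-> ep *: z.1.1 <> e.
Proof.
move=> ee [[Sp _] _].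
have Sep : sphere (ep *: z.1.1) by rewrite /sphere /= !dotL mulrA ee mul1r.
rewrite (sphere_pole Sep) /chart_dom /= subr_eq0 eq_sym.
by rewrite !mxE.
Qed.

Lemma Zset_chart ep q : ep * ep = 1 -> 0 < q.2 -> Zset (chart ep q).
Proof.
move=> ee q0; split=> //; split; rewrite /sphere /= !dotL mulrA ee mul1r.
  exact: sphere_stereo_inv.
by rewrite -refl_p0 dot_refl dot_p0_col0.
Qed.

Lemma chart_dom_chart ep q : ep * ep = 1 -> 0 < q.2 -> chart_dom ep (chart ep q).
Proof.
move=> ee q0; apply/chart_domP => //; first exact: Zset_chart.
by rewrite /= scalerA ee scale1r; exact: stereo_inv_neq.
Qed.

Lemma chartK ep q : ep * ep = 1 -> chart_inv ep (chart ep q) = q.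
Proof.
case: q => -[x y] s ee; rewrite /chart_inv /chart /= !scalerA ee !scale1r.
by rewrite stereo_invK reflK col_mxKu.
Qed.

Lemma chart_invK ep z : ep * ep = 1 -> Zset z -> chart_dom ep z ->
  chart ep (chart_inv ep z) = z.
Proof.
move=> ee Zz /(chart_domP ee Zz) pe; case: (Zz) => -[Sp pv] _.
have Sep : sphere (ep *: z.1.1) by rewrite /sphere /= !dotL mulrA ee mul1r.
rewrite /chart /chart_inv /= stereoK// -p0_tangent ?reflK ?scalerA ?ee ?scale1r//.
  by case: (z) => -[].
by rewrite -(dot_refl (stereo (ep *: z.1.1))) refl_p0 reflK stereoK// !dotL mulrA ee mul1r.
Qed.

Lemma smooth_chart V (U : set V) ep (q : V -> coord) : open U -> smooth_on U q ->
  smooth_on U (fun t => chart ep (q t)).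
Proof.
move=> oU sq; have sx : smooth_on U (fun t => (q t).1.1) by do 2![apply: smooth_fst => //].
have se := smooth_cst oU ep.
apply: smooth_pair => //; last exact: smooth_snd.
apply: smooth_pair => //; first by apply: smooth_scale => //; exact: smooth_stereo_inv.
apply: smooth_scale => //; apply: smooth_mulmx => //; first exact: smooth_refl.
apply: smooth_col_mx => //; last exact: smooth_cst.
by apply: smooth_snd => //; exact: smooth_fst.
Qed.

Lemma smooth_stereo V (U : set V) (p : V -> 'cV[R]_N) : open U -> smooth_on U p ->
  (forall t, U t -> 1 - dsubmx (p t) 0 0 != 0) -> smooth_on U (fun t => stereo (p t)).
Proof.
move=> oU sp p1; apply: smooth_scale => //; last exact: smooth_usubmx.
apply: smoothV => //; apply: smoothB => //; first exact: smooth_cst.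
by apply: smooth_entry => //; exact: smooth_dsubmx.
Qed.

Lemma smooth_chart_inv ep : smooth_on (chart_dom ep) (chart_inv ep).
Proof.
have oD := @open_chart_dom ep; have si := smooth_id oD.
have sp : smooth_on (chart_dom ep) (fun z => ep *: z.1.1).
  by apply: smooth_scale => //; [exact: smooth_cst|do 2![apply: smooth_fst => //]].
have sx : smooth_on (chart_dom ep) (fun z => stereo (ep *: z.1.1)).
  by apply: smooth_stereo => // z; rewrite /chart_dom /= !mxE.
apply: smooth_pair => //; last exact: smooth_snd.
apply: smooth_pair => //; apply: smooth_usubmx => //; apply: smooth_mulmx => //.
  exact: smooth_refl.
apply: smooth_scale => //; first exact: smooth_cst.
by apply: smooth_snd => //; exact: smooth_fst.
Qed.

(** The coordinates are taken through [a] and [b] so that one lemma serves Z, the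
submanifolds where [s = 1] or where moreover [y = 0], and [kappa]. *)
Lemma chart_diffeo V (O : set V) (X : set Zamb) ep (a : V -> coord) (b : coord -> V) :
  ep * ep = 1 -> open O -> smooth_on O a ->
  smooth_on (chart_dom ep) (fun z => b (chart_inv ep z)) -> X `<=` Zset ->
  (forall c, O c -> [/\ 0 < (a c).2, X (chart ep (a c)) & b (a c) = c]) ->
  (forall z, X z -> chart_dom ep z ->
    O (b (chart_inv ep z)) /\ a (b (chart_inv ep z)) = chart_inv ep z) ->
  diffeo O (X `&` chart_dom ep) (fun c => chart ep (a c)).
Proof.
move=> ee oO sa sb XZ aP bP; exists (fun z => b (chart_inv ep z)); split.
- by move=> c /aP[a0 Xa _]; split=> //; exact: chart_dom_chart.
- by move=> z [Xz Dz]; have [] := bP _ Xz Dz.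
- split=> [c /set_mem/aP[a0 Xa ba]|z /set_mem[Xz Dz]]; first by rewrite chartK.
  by have [_ ->] := bP _ Xz Dz; rewrite chart_invK//; exact: XZ.
- by apply: (smooth_map_on oO) => //; exact: smooth_chart.
- apply: (smooth_map_on (@open_chart_dom ep)) => //; exact: subIsetr.
Qed.

Lemma chart_cover z : exists2 ep : R, ep * ep = 1 & chart_dom ep z.
Proof.
have [z1|z1] := eqVneq (dsubmx z.1.1 0 0) 1; last first.
  by exists 1; rewrite ?mulr1// /chart_dom /= mul1r subr_eq0 eq_sym.
exists (-1); first by rewrite mulrNN mulr1.
by rewrite /chart_dom /= z1 mulr1 opprK.
Qed.

Lemma submanifold_Zset : submanifold (n + n).+1 (@Zset R n).
Proof.
move=> z Zz; have [ep ee Dz] := chart_cover z.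
have oD := @open_chart_dom ep.
pose W := 'cV[R]_(1 + (n + n)).
pose a (c : W) : coord :=
  (usubmx (dsubmx c), dsubmx (dsubmx c), usubmx c 0 0).
pose b q : W := col_mx q.2%:M (col_mx q.1.1 q.1.2).
have sW (X : set W) : open X -> smooth_on X a.
  move=> oX; have si := smooth_id oX.
  apply: smooth_pair => //; first apply: smooth_pair => //.
  - by apply: smooth_usubmx => //; exact: smooth_dsubmx.
  - by apply: smooth_dsubmx => //; exact: smooth_dsubmx.
  - by apply: smooth_entry => //; exact: smooth_usubmx.
have oO : open [set c : W | setT c /\ 0 < usubmx c 0 0].
  apply: open_smooth_gt0 => //; apply: smooth_entry => //; apply: smooth_usubmx => //.
  exact: smooth_id.
have abK q : a (b q) = q.
  case: q => -[x y] s; rewrite /a /b; congr (_, _, _).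
  - by rewrite col_mxKd col_mxKu.
  - by rewrite !col_mxKd.
  - by rewrite col_mxKu mxE.
exists (chart_dom ep), [set c : W | setT c /\ 0 < usubmx c 0 0], (fun c => chart ep (a c)).
split=> //; apply: (@chart_diffeo _ _ _ _ a b) => //; first exact: sW.
- have sc := smooth_chart_inv ep.
  apply: smooth_col_mx => //; first by apply: smooth_scalar_mx => //; exact: smooth_snd.
  apply: smooth_col_mx => //; first by do 2![apply: smooth_fst => //].
  by apply: smooth_snd => //; exact: smooth_fst.
- move=> c [_ c0]; split=> //; first exact: Zset_chart.
  by rewrite /b /= -mx11_scalar !vsubmxK.
- move=> z' [_ z'0] _; rewrite abK; split=> //; split=> //.
  by rewrite /b col_mxKu mxE eqxx.
Qed.

Lemma submanifold_Stilde : submanifold (n + n) (@Stilde R n).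
Proof.
move=> z [Tz z1]; have [ep ee Dz] := chart_cover z.
have oD := @open_chart_dom ep.
pose W := 'cV[R]_(n + n).
pose a (c : W) : coord := (usubmx c, dsubmx c, 1).
pose b q : W := col_mx q.1.1 q.1.2.
exists (chart_dom ep), setT, (fun c => chart ep (a c)).
split=> //; apply: (@chart_diffeo _ _ _ _ a b) => //.
- have si := @smooth_id _ _ _ (@openT W).
  apply: smooth_pair => //; last exact: smooth_cst.
  by apply: smooth_pair => //; [exact: smooth_usubmx|exact: smooth_dsubmx].
- have sc := smooth_chart_inv ep.
  apply: smooth_col_mx => //; first by do 2![apply: smooth_fst => //].
  by apply: smooth_snd => //; exact: smooth_fst.
- by move=> z' [T1 z'1]; split=> //; rewrite /= z'1.
- move=> c _; split=> //; last by rewrite /b /= vsubmxK.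
  by have [? _] := @Zset_chart ep (a c) ee ltr01; split.
- by move=> z' [_ z'1] _; split=> //; rewrite /a /b col_mxKu col_mxKd /chart_inv /= z'1.
Qed.

Lemma submanifold_Etilde : submanifold n (@Etilde R n).
Proof.
rewrite EtildeE// => _ [p Sp <-]; have [ep ee Dz] := chart_cover (p, 0, 1).
have oD := @open_chart_dom ep.
pose a (x : 'cV[R]_n) : coord := (x, 0, 1).
pose b q : 'cV[R]_n := q.1.1.
exists (chart_dom ep), setT, (fun x => chart ep (a x)).
split=> //; apply: (@chart_diffeo _ _ _ _ a b) => //.
- apply: smooth_pair => //; last exact: smooth_cst.
  by apply: smooth_pair => //; [exact: smooth_id|exact: smooth_cst].
- by have sc := smooth_chart_inv ep; do 2![apply: smooth_fst => //].
- by move=> _ [q Sq <-]; exact: Zset_unit.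
- move=> x _; split=> //.
  have [[Sq _] _] := @Zset_chart ep (a x) ee ltr01.
  by exists (ep *: stereo_inv x) => //; rewrite /chart /= col_mx0 mulmx0 scaler0.
- move=> _ [q Sq <-] _; split=> //; rewrite /a /b /chart_inv /=.
  by rewrite scaler0 mulmx0 linear0.
Qed.

Lemma Z_differential : differential_groupoid (n + n).+1 n (@Zset R n) Etilde
  (@eL R n) (@eR R n) (@stilde R n) (@mtilde R n).
Proof.
split; first exact: Z_groupoid_tilde.
- by split; [exact: submanifold_Zset|exact: submanifold_Etilde].
- by split; [exact: submersion_eL|exact: submersion_eR].
- exact: smooth_map_stilde.
- exact: smooth_map_mtilde.
Qed.

End SmoothGroupoid.

(** * The groupoid in coordinates *)

(** Exact difference quotient: [g] is the slope of [f] from [0], extended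
continuously to [0]. *)
Lemma derive1_slope {R : realType} (W : normedModType R) (f g : R -> W) :
  (forall t, f t = f 0 + t *: g t) -> {for 0, continuous g} -> derive1 f 0 = g 0.
Proof.
move=> fg cg; rewrite /derive1; apply: cvg_lim; first exact: norm_hausdorff.
apply: cvg_trans (cvg_within_filter _ cg); apply: near_eq_cvg.
near=> h; rewrite addr0 fg addrC addKr scalerA mulVf ?scale1r//.
by near: h; exact: nbhs_dnbhs_neq.
Unshelve. all: by end_near. Qed.

Lemma isotropy_group (T : Type) (X E : set T) l r s m u :
  is_groupoid X E l r s m -> E u -> is_group (isotropy X l r u) u s m.
Proof.
move=> gX Eu.
have cI x y : isotropy X l r u x -> isotropy X l r u y -> composable X l r (x, y).
  by move=> [Xx lx rx] [Xy ly ry]; split; rewrite //= rx ly.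
split.
- by split; [exact: (units_sub gX)|exact: (lproj_id gX)|exact: (rproj_id gX)].
- move=> x [Xx lx rx]; split; first exact: (inv_closed gX).
    by rewrite (lproj_inv gX).
  by rewrite (rproj_inv gX).
- move=> x y Ix Iy; have cxy := cI _ _ Ix Iy.
  case: Ix Iy => [_ lx _] [_ _ ry]; split; first exact: (mul_closed gX).
    by rewrite (lproj_mul gX cxy).
  by rewrite (rproj_mul gX cxy).
- by move=> x y z Ix Iy Iz; apply: (mul_assoc gX); exact: cI.
- move=> x [Xx lx rx]; split.
  + by rewrite -{1}lx (mul_lunit gX).
  + by rewrite -{1}rx (mul_runit gX).
  + by rewrite (mul_inv_l gX).
  + by rewrite (mul_inv_r gX).
Qed.

Section Coordinates.
Context {R : realType} {n : nat}.
Notation N := (n + 1)%N.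
Notation Zamb := (Zamb R n).
Notation e := (@p0 R n).
Implicit Types (x y xd : 'cV[R]_n) (s : R) (z : Zamb).

Lemma F0P z : F0 z <-> exists s y, 0 < s /\ z = F0coord s y.
Proof.
split=> [[zp zv z0]|[s [y [s0 ->]]]]; last by split => //=; exact: dot_p0_col0.
exists z.2, (usubmx z.1.2); split=> //.
by rewrite /F0coord -p0_tangent// -zp; case: z {zp zv z0} => -[].
Qed.

Lemma Z1P z : Z1 z <-> exists x y s, 0 < s /\ z = Zcoord x y s.
Proof.
split=> [[/ZsetP[s y s0 -> //|x y s s0 ->]]|[x [y [s [s0 ->]]]]].
  by move=> _; exists x, y, s.
by split; [exact: Zset_Zcoord|exact: stereo_inv_neq].
Qed.

Lemma F0_Zset z : F0 z -> Zset z.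
Proof. by move=> /F0P[s [y [s0 ->]]]; exact: Zset_F0coord. Qed.

Lemma Z1_Zset z : Z1 z -> Zset z.
Proof. by case. Qed.

Lemma zl_Zcoord x y s : zl (Zcoord x y s) = Zcoord x 0 1.
Proof. by rewrite /zl /Zcoord /= col_mx0 mulmx0. Qed.

Lemma zr_Zcoord x y s : 0 < s -> zr (Zcoord x y s) = Zcoord (s *: x - y) 0 1.
Proof.
by move=> s0; rewrite /zr coc_Zcoord//= -mulmxA -refl_p0 reflK refl_p0 /Zcoord col_mx0 mulmx0.
Qed.

Lemma zinv_Zcoord x y s : 0 < s ->
  zinv (Zcoord x y s) = Zcoord (s *: x - y) (- (s^-1 *: y)) s^-1.
Proof.
move=> s0; rewrite /zinv coc_Zcoord// /Zcoord /=; congr (_, _, _).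
  by rewrite -mulmxA -refl_p0 reflK refl_p0.
rewrite -mulmxA reflK.
have -> : col_mx (- (s^-1 *: y)) 0 = - (s^-1 *: col_mx y 0) :> 'cV[R]_N.
  by rewrite scale_col_mx scaler0 opp_col_mx oppr0.
by rewrite mulmxN -scalemxAr.
Qed.

Lemma zmul_Zcoord x1 y1 s1 y2 s2 : 0 < s1 ->
  zmul (Zcoord x1 y1 s1) (Zcoord (s1 *: x1 - y1) y2 s2) =
  Zcoord x1 (s2 *: y1 + y2) (s1 * s2).
Proof.
move=> s10; rewrite /zmul coc_Zcoord// /Zcoord /=; congr (_, _, _).
rewrite trmx_mul !refl_tr -mulmxA reflK scalemxAr -mulmxDr.
by rewrite scale_col_mx add_col_mx scaler0 addr0.
Qed.

Lemma composable_Zcoord x1 y1 s1 x2 y2 s2 : 0 < s1 -> 0 < s2 ->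
  composable Zset zl zr (Zcoord x1 y1 s1, Zcoord x2 y2 s2) <-> x2 = s1 *: x1 - y1.
Proof.
move=> s10 s20; split=> [[_ _ /=]|->].
  by rewrite zr_Zcoord// zl_Zcoord => -[/(can_inj stereo_invK)].
by split; [exact: Zset_Zcoord|exact: Zset_Zcoord|rewrite /= zr_Zcoord// zl_Zcoord].
Qed.

(** By [stereo_invE] the curve is [p0 + phi t *: (pole_vec x + t *: w)], and [phi] is a
rational function whose difference quotient is explicit. *)
Lemma kappaE x xd s : kappa x xd s = Zcoord x ((2 / (1 + dot x x)) *: xd) s.
Proof.
rewrite /kappa /Zcoord; congr (_, _, _).
pose w : 'cV[R]_N := col_mx xd 0.
pose phi (t : R) : R := 2 / (1 + dot (x + t *: xd) (x + t *: xd)).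
pose g (t : R) : 'cV[R]_N :=
  phi t *: w - (phi 0 * phi t * (dot x xd + t * dot xd xd / 2)) *: pole_vec x.
have phi0 : phi 0 = 2 / (1 + dot x x) by rewrite /phi scale0r addr0.
rewrite (@derive1_slope _ _ _ g).
- rewrite refl_act /g phi0 -/w.
  have -> : col_mx ((2 / (1 + dot x x)) *: xd) 0 = (2 / (1 + dot x x)) *: w.
    by rewrite /w scale_col_mx scaler0.
  congr (_ - _ *: _); rewrite !dotL /w /pole_vec dot_col dot0r addr0 mul0r mul0r addr0.
  by rewrite -mulrA.
- move=> t; rewrite !stereo_invE scale0r addr0 -/(phi t) -phi0 /g.
  have -> : pole_vec (x + t *: xd) = pole_vec x + t *: w.
    by rewrite /pole_vec /w scale_col_mx add_col_mx scaler0 addr0.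
  have D0 := dot1_neq0 x; have Dt := dot1_neq0 (x + t *: xd).
  have E : phi t = phi 0 - t * (phi 0 * phi t * (dot x xd + t * dot xd xd / 2)).
    rewrite phi0 /phi; move: Dt; rewrite !dotL [dot xd x]dotC => Dt.
    by field; rewrite Dt D0.
  by apply/matrixP => i j; rewrite !mxE mulrDr {1}E; ring.
- have sphi : smooth_on setT phi.
    have sx : smooth_on setT (fun t : R => x + t *: xd).
      apply: smoothD => //; first exact: smooth_cst.
      by apply: smooth_scale => //; [exact: smooth_id|exact: smooth_cst].
    apply: smooth_div => //; first exact: smooth_cst.
      by apply: smoothD => //; [exact: smooth_cst|exact: smooth_dot].
    by move=> t _; exact: dot1_neq0.
  apply: (smooth_continuous (U := setT)) => //; apply: smoothB => //.
    by apply: smooth_scale => //; exact: smooth_cst.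
  apply: smooth_scale => //; last exact: smooth_cst.
  apply: smoothM => //; first by apply: smoothM => //; exact: smooth_cst.
  apply: smoothD => //; first exact: smooth_cst.
  apply: smoothM => //; last exact: smooth_cst.
  by apply: smoothM => //; [exact: smooth_id|exact: smooth_cst].
Qed.

Definition conf x : R := 2 / (1 + dot x x).

Lemma conf_gt0 x : 0 < conf x.
Proof. by rewrite divr_gt0// dot1_gt0. Qed.

Lemma conf_neq0 x : conf x != 0.
Proof. by rewrite gt_eqF// conf_gt0. Qed.

Lemma Zcoord_kappa x y s : Zcoord x y s = kappa x ((conf x)^-1 *: y) s.
Proof. by rewrite kappaE -/(conf x) scalerA divff ?conf_neq0// scale1r. Qed.

Lemma kappa_unit x : kappa x 0 1 = Zcoord x 0 1.
Proof. by rewrite kappaE scaler0. Qed.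

Lemma Z1_kappa z : Z1 z -> exists x xd s, 0 < s /\ z = kappa x xd s.
Proof.
move=> /Z1P[x [y [s [s0 ->]]]]; rewrite Zcoord_kappa.
by exists x, ((conf x)^-1 *: y), s.
Qed.

Lemma Z1_Zcoord x y s : 0 < s -> Z1 (Zcoord x y s).
Proof. by move=> s0; apply/Z1P; exists x, y, s. Qed.

Lemma Z1_chart : @Z1 R n = Zset `&` chart_dom 1.
Proof.
have e1 : 1 * 1 = 1 :> R by rewrite mulr1.
apply/seteqP; split=> z [Zz pz]; split=> //.
  by apply/(chart_domP e1 Zz); rewrite scale1r.
by move/(chart_domP e1 Zz): pz; rewrite scale1r.
Qed.

Lemma kappa_diffeo :
  diffeo [set q : 'cV[R]_n * 'cV[R]_n * R | 0 < q.2] Z1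
    (fun q => kappa q.1.1 q.1.2 q.2).
Proof.
pose a (q : 'cV[R]_n * 'cV[R]_n * R) : 'cV[R]_n * 'cV[R]_n * R :=
    (q.1.1, conf q.1.1 *: q.1.2, q.2).
pose b (q : 'cV[R]_n * 'cV[R]_n * R) : 'cV[R]_n * 'cV[R]_n * R :=
    (q.1.1, (conf q.1.1)^-1 *: q.1.2, q.2).
have -> : (fun q : 'cV[R]_n * 'cV[R]_n * R => kappa q.1.1 q.1.2 q.2) =
    (fun q => chart 1 (a q)).
  by apply/funext => q; rewrite kappaE /chart /a /= !scale1r.
rewrite Z1_chart.
have oO : open [set q : 'cV[R]_n * 'cV[R]_n * R | 0 < q.2].
  rewrite (_ : mkset _ = [set q : 'cV[R]_n * 'cV[R]_n * R | setT q /\ 0 < q.2]).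
    by apply: open_smooth_gt0 => //; apply: smooth_snd => //; exact: smooth_id.
  by apply/seteqP; split=> [q ?|q []].
have sconf (V : normedModType R) (U : set V) (x : V -> 'cV[R]_n) : open U -> smooth_on U x ->
    smooth_on U (fun t => conf (x t)).
  move=> oU sx; apply: smooth_div => //; first exact: smooth_cst.
    by apply: smoothD => //; [exact: smooth_cst|exact: smooth_dot].
  by move=> t _; exact: dot1_neq0.
apply: (@chart_diffeo _ _ _ _ _ _ a b) => //.
- by rewrite mulr1.
- have si := smooth_id oO.
  have s1 : smooth_on [set q : 'cV[R]_n * 'cV[R]_n * R | 0 < q.2] (fun q => q.1.1).
    by do 2![apply: smooth_fst => //].
  apply: smooth_pair => //; last exact: smooth_snd.
  apply: smooth_pair => //; apply: smooth_scale => //; first exact: sconf.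
  by apply: smooth_snd => //; exact: smooth_fst.
- have oD := @open_chart_dom R n 1; have sc := @smooth_chart_inv R n 1.
  have s1 : smooth_on (chart_dom 1) (fun z : Zamb => (chart_inv 1 z).1.1).
    by do 2![apply: smooth_fst => //].
  apply: smooth_pair => //; last exact: smooth_snd.
  apply: smooth_pair => //; apply: smooth_scale => //; last first.
    by apply: smooth_snd => //; exact: smooth_fst.
  by apply: smoothV => //; [exact: sconf|move=> z _; exact: conf_neq0].
- move=> [[x xd] s] /= s0; split=> //; first by apply: Zset_chart; rewrite ?mulr1.
  by rewrite /b /a /= scalerA mulVf ?scale1r// conf_neq0.
- move=> z [_ z0] _; split=> //.
  case: (chart_inv 1 z) => -[x y] s.
  by rewrite /a /b /= scalerA divff ?conf_neq0// scale1r.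
Qed.

Context (n0 : (0 < n)%N).

Lemma stilde_kappa x xd s : 0 < s ->
  stilde (kappa x xd s) =
    kappa (s *: x - (2 / (1 + dot x x)) *: xd)
      (- (((1 + dot (s *: x - (2 / (1 + dot x x)) *: xd)
                    (s *: x - (2 / (1 + dot x x)) *: xd))
           / (1 + dot x x)) *: (s^-1 *: xd)))
      s^-1.
Proof.
move=> s0; rewrite !kappaE stildeE//; last exact: Zset_Zcoord.
rewrite zinv_Zcoord//; congr Zcoord; set x2 := s *: x - _.
rewrite scalerN !scalerA; congr (- (_ *: _)).
by field; rewrite !dot1_neq0 gt_eqF.
Qed.

Lemma eL_kappa x xd s : 0 < s -> eL (kappa x xd s) = kappa x 0 1.
Proof.
by move=> s0; rewrite kappaE eLE ?zl_Zcoord ?kappa_unit//; exact: Zset_Zcoord.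
Qed.

Lemma eR_kappa x xd s : 0 < s ->
  eR (kappa x xd s) = kappa (s *: x - (2 / (1 + dot x x)) *: xd) 0 1.
Proof.
by move=> s0; rewrite kappaE eRE ?zr_Zcoord ?kappa_unit//; exact: Zset_Zcoord.
Qed.

Lemma graph_mtilde_kappa :
  [set t | [/\ @graph_mtilde R n t, Z1 t.1.1, Z1 t.1.2 & Z1 t.2]] =
  [set t | exists x1 xd1 s1 x2 xd2 s2,
    [/\ 0 < s1, 0 < s2, x2 = s1 *: x1 - (2 / (1 + dot x1 x1)) *: xd1 &
        t = (kappa x1 (s2 *: xd1 + ((1 + dot x1 x1) / (1 + dot x2 x2)) *: xd2) (s1 * s2),
             kappa x1 xd1 s1, kappa x2 xd2 s2)]].
Proof.
have mulE x1 xd1 s1 x2 xd2 s2 : 0 < s1 -> x2 = s1 *: x1 - (2 / (1 + dot x1 x1)) *: xd1 ->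
    zmul (kappa x1 xd1 s1) (kappa x2 xd2 s2) =
    kappa x1 (s2 *: xd1 + ((1 + dot x1 x1) / (1 + dot x2 x2)) *: xd2) (s1 * s2).
  move=> s10 xE; rewrite !kappaE {1}xE zmul_Zcoord//; congr Zcoord.
  rewrite scalerDr !scalerA [s2 * _]mulrC; congr (_ + _ *: _).
  by field; rewrite !dot1_neq0.
have cE x1 xd1 s1 x2 xd2 s2 : 0 < s1 -> 0 < s2 ->
    composable Zset zl zr (kappa x1 xd1 s1, kappa x2 xd2 s2) <->
    x2 = s1 *: x1 - (2 / (1 + dot x1 x1)) *: xd1.
  by move=> s10 s20; rewrite !kappaE; exact: composable_Zcoord.
apply/seteqP; split=> [[[z z1] z2] [/= gz _ Zz1 Zz2]|].
  have [x1 [xd1 [s1 [s10 z1E]]]] := Z1_kappa Zz1.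
  have [x2 [xd2 [s2 [s20 z2E]]]] := Z1_kappa Zz2.
  move: gz; rewrite z1E z2E => /(graph_mtildeE n0)[/(cE _ _ _ _ _ _ s10 s20) xE ->].
  exists x1, xd1, s1, x2, xd2, s2; split=> //.
  by rewrite (mulE _ _ _ _ _ _ s10 xE).
move=> _ [x1 [xd1 [s1 [x2 [xd2 [s2 [s10 s20 xE ->]]]]]]] /=.
split; [|rewrite kappaE; apply: Z1_Zcoord => //..]; last by rewrite mulr_gt0.
apply/(graph_mtildeE n0); split; last by rewrite mulE.
exact/cE.
Qed.

Lemma Z1_subgroupoid : subgroupoid (@Zset R n) (@eL R n) (@eR R n) (@stilde R n)
  (@mtilde R n) Z1.
Proof.
split; first exact: Z1_Zset.
  move=> z Zz; have ZZ := Z1_Zset Zz; rewrite eLE// eRE// stildeE//.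
  move: Zz => /Z1P[x [y [s [s0 ->]]]]; rewrite zl_Zcoord zr_Zcoord// zinv_Zcoord//.
  by split; apply: Z1_Zcoord => //; rewrite invr_gt0.
move=> z1 z2 Z1z Z2z E; have c12 : composable Zset (@eL R n) (@eR R n) (z1, z2).
  by split=> //; exact: Z1_Zset.
have ZZ := mul_closed (Z_groupoid_tilde n0) c12.
by split=> //; rewrite (mtildeE n0 c12) /=; case: Z1z.
Qed.

Lemma Z1_transitive : transitive_groupoid (@Z1 R n) (Etilde `&` Z1) (@eL R n) (@eR R n).
Proof.
have unitE z : (Etilde `&` Z1) z -> exists x, z = Zcoord x 0 1.
  rewrite (EtildeE n0) => -[[p Sp <-] /Z1P[x [y [s [s0 [pE yE sE]]]]]].
  by exists x; rewrite /Zcoord -pE col_mx0 mulmx0.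
move=> z z' /unitE[x ->] /unitE[x' ->].
exists (Zcoord x (x - x') 1); have Zx := Zset_Zcoord x (x - x') ltr01.
split; [exact: Z1_Zcoord|by rewrite eLE// zl_Zcoord|].
by rewrite eRE// zr_Zcoord// scale1r opprB addrC subrK.
Qed.

Lemma Z1_isotropy x0 :
  isotropy Z1 (@eL R n) (@eR R n) (kappa x0 0 1) =
    [set kappa x0 (((s - 1) * (1 + dot x0 x0) / 2) *: x0) s
      | s in [set s : R | 0 < s]].
Proof.
apply/seteqP; split=> [z [/Z1P[x [y [s [s0 ->]]]]]|_ [s s0 <-]].
  have Zz := Zset_Zcoord x y s0.
  rewrite eLE// eRE// zl_Zcoord zr_Zcoord// kappa_unit.
  move=> [/(can_inj stereo_invK)-> _] [/(can_inj stereo_invK) xE _].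
  exists s => //; rewrite kappaE; congr Zcoord.
  have -> : y = (s - 1) *: x0.
    by rewrite scalerBl scale1r -[X in _ - X]xE opprB addrC subrK.
  rewrite scalerA; congr (_ *: _).
  by field; rewrite dot1_neq0.
split; first by rewrite kappaE; exact: Z1_Zcoord.
  by rewrite eL_kappa.
rewrite (eR_kappa _ _ s0).
have -> // : s *: x0 - (2 / (1 + dot x0 x0)) *: (((s - 1) * (1 + dot x0 x0) / 2) *: x0) = x0.
rewrite scalerA -scalerBl -[RHS]scale1r; congr (_ *: _).
by field; rewrite dot1_neq0.
Qed.

Lemma Zset_F0_Z1 : @Zset R n = F0 `|` Z1.
Proof.
apply/seteqP; split=> [z Zz|z [/F0_Zset|/Z1_Zset]//].
have [[pe]|pe] := pselect (z.1.1 = e); last by right.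
by left; case: Zz => -[_ pv] s0; split=> //; rewrite -pe.
Qed.

Lemma eL_fiber_p0 : [set z : Zamb | Zset z /\ eL z = (e, 0, 1)] = F0.
Proof.
apply/seteqP; split=> [z [Zz]|z Fz]; last first.
  have Zz := F0_Zset Fz; split; first exact: Zz.
  by rewrite eLE// /zl; case: Fz => ->.
by rewrite eLE// => -[pe]; case: Zz => -[_ pv] s0; split=> //; rewrite -pe.
Qed.

Lemma eR_fiber_p0 : [set z : Zamb | Zset z /\ eR z = (e, 0, 1)] = F0.
Proof.
apply/seteqP; split=> [z [Zz]|z Fz].
  rewrite eRE//; case/ZsetP: Zz => [s y s0 -> _|x y s s0 ->].
    by apply/F0P; exists s, y.
  by rewrite zr_Zcoord// => -[/stereo_inv_neq].
split; first exact: F0_Zset.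
rewrite eRE//; last exact: F0_Zset.
by move: Fz => /F0P[s [y [s0 ->]]]; rewrite /zr coc_F0coord// mul1mx.
Qed.

Lemma F0_group : is_group (@F0 R n) (e, 0, 1) (@stilde R n) (@mtilde R n).
Proof.
have -> : @F0 R n = isotropy Zset (@eL R n) (@eR R n) (e, 0, 1).
  apply/seteqP; split=> [z Fz|z [Zz lz _]]; last by rewrite -eL_fiber_p0.
  have := Fz; rewrite -{1}eL_fiber_p0 => -[_ lz].
  by have := Fz; rewrite -{1}eR_fiber_p0 => -[Zz rz].
apply: isotropy_group; first exact: Z_groupoid_tilde.
by rewrite (EtildeE n0); exists e => //; exact: dot_p0.
Qed.

Lemma Z1_open : open_in (@Zset R n) Z1.
Proof. by exists (chart_dom 1); [exact: open_chart_dom|exact: Z1_chart]. Qed.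

(** A point over [p0] is approached in the chart centered at [p0], along a
line through the origin. *)
Lemma Z1_dense : @Zset R n = Zset `&` closure Z1.
Proof.
apply/seteqP; split=> [z Zz|z []//]; split=> //.
have := Zz; rewrite Zset_F0_Z1 => -[|Z1z]; last exact: subset_closure.
move=> /F0P[s [y [s0 zE]]] B nB.
have ee : -1 * -1 = 1 :> R by rewrite mulrNN mulr1.
pose c (t : R) : Zamb := chart (-1) (t *: const_mx 1, - y, s).
have c0 : c 0 = z.
  rewrite /c /chart /= scale0r zE /F0coord; congr (_, _, _).
    rewrite /stereo_inv dot0l !scaler0 !add0r divr1 scale_col_mx scaler0.
    by rewrite scale_scalar_mx mulrNN mulr1.
  rewrite refl_act /pole_vec dot_col !dot0l !dot0r !addr0 mulr0 scale0r subr0.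
  by rewrite scaleN1r opp_col_mx opprK oppr0.
have sc : smooth_on setT c.
  apply: smooth_chart => //; apply: smooth_pair => //; last exact: smooth_cst.
  apply: smooth_pair => //; last exact: smooth_cst.
  by apply: smooth_scale => //; [exact: smooth_id|exact: smooth_cst].
have cc := smooth_continuous sc (I : setT (0 : R)).
have nc : \forall t \near (0 : R)^', B (c t).
  have : c @ (0 : R)^' --> c 0 by exact: cvg_within_filter cc.
  by rewrite c0 => /(_ B nB).
have nt : \forall t \near (0 : R)^', t != 0 by exact: nbhs_dnbhs_neq.
have [t [Bt t0]] : exists t, B (c t) /\ t != 0.
  apply: (@filter_ex _ (0 : R)^' _ (fun t => B (c t) /\ t != 0)).
  by apply: filterS2 nc nt.
exists (c t); split=> //; split; first exact: Zset_chart.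
move=> /= E; have := congr1 (fun z => z.1.1) c0.
rewrite zE /= -E scale0r => /(scalerI (_ : -1 != 0)).
rewrite oppr_eq0 oner_eq0 => /(_ isT)/(can_inj stereo_invK)/matrixP/(_ (Ordinal n0) 0).
by rewrite !mxE mulr1 => /esym/eqP; rewrite (negbTE t0).
Qed.

End Coordinates.

(** * The subgroupoids over the pole and at s = 1 *)

Section SpecialSubgroupoids.
Context {R : realType} {n : nat} (n0 : (0 < n)%N).
Notation N := (n + 1)%N.
Notation Zamb := (Zamb R n).
Notation e := (@p0 R n).
Implicit Types (y mu : 'cV[R]_n) (s : R) (z : Zamb).

Lemma mtilde_F0 s1 s2 mu1 mu2 : 0 < s1 -> 0 < s2 ->
  mtilde (F0coord s1 mu1) (F0coord s2 mu2) = F0coord (s1 * s2) (s2 *: mu1 + mu2).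
Proof.
move=> s10 s20; have Z1 := Zset_F0coord mu1 s10; have Z2 := Zset_F0coord mu2 s20.
have c12 : composable Zset zl zr (F0coord s1 mu1, F0coord s2 mu2).
  by apply/composableE; split=> //; rewrite coc_F0coord// mul1mx.
rewrite (mtildeE n0) /zmul ?coc_F0coord//; last exact/composable_eLR.
rewrite /F0coord /= trmx1 mul1mx; congr (_, _, _).
by rewrite scale_col_mx add_col_mx scaler0 addr0.
Qed.

Lemma stilde_F0 s mu : 0 < s ->
  stilde (F0coord s mu) = F0coord s^-1 (- (s^-1 *: mu)).
Proof.
move=> s0; rewrite (stildeE n0) /zinv ?coc_F0coord//; last exact: Zset_F0coord.
rewrite /F0coord /= !mul1mx; congr (_, _, _).
by rewrite scale_col_mx scaler0 opp_col_mx oppr0.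
Qed.

Lemma F0_diffeo_C : exists phi : Zamb -> 'M[R]_(1 + N),
  [/\ diffeo F0 C phi,
      forall z1 z2, F0 z1 -> F0 z2 -> phi (mtilde z1 z2) = phi z1 *m phi z2 &
      forall s mu, 0 < s -> phi (F0coord s mu) = Cmx s mu].
Proof.
pose phi z : 'M[R]_(1 + N) := Cmx z.2 (usubmx z.1.2).
have phiE s mu : phi (F0coord s mu) = Cmx s mu by rewrite /phi /= col_mxKu.
exists phi; split=> //; last first.
  move=> _ _ /F0P[s1 [y1 [s10 ->]]] /F0P[s2 [y2 [s20 ->]]].
  by rewrite mtilde_F0// !phiE Cmx_mul// gt_eqF.
have sE s y : 0 < s -> sfac (Cmx s y) = s.
  by move=> s0; rewrite -[Cmx s y]mulmx1 -dg1 sfacE// gt_eqF.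
have yE s y : yfac (Cmx s y) = y by rewrite -[Cmx s y]mulmx1 -dg1 yfacE.
exists (fun c => F0coord (sfac c) (yfac c)); split.
- by move=> _ /F0P[s [y [s0 ->]]]; rewrite /= phiE; exact: C_Cmx.
- by move=> _ [s [y [s0 ->]]]; apply/F0P; exists s, y; rewrite sE// yE.
- split=> [z /set_mem/F0P[s [y [s0 ->]]]|c /set_mem[s [y [s0 ->]]]].
    by rewrite phiE sE// yE.
  by rewrite sE// yE phiE.
- have s2 : smooth_on setT (fun z : Zamb => z.2) by apply: smooth_snd => //; exact: smooth_id.
  have oU := open_smooth_neq0 openT s2.
  apply: (@smooth_map_on _ _ _ _ _ phi phi oU) => //.
    by move=> z [_ _ z0]; split; rewrite ?gt_eqF.
  have si := smooth_id oU.
  apply: smooth_Cmx => //; [exact: smooth_snd| |by move=> z []].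
  by apply: smooth_usubmx => //; apply: smooth_snd => //; exact: smooth_fst.
- have si := @smooth_id _ _ _ (@openT 'M[R]_(1 + N)).
  apply: (smooth_map_on openT) => //.
  apply: smooth_pair => //; last exact: smooth_sfac.
  apply: smooth_pair => //; first exact: smooth_cst.
  by apply: smooth_col_mx => //; [exact: smooth_yfac|exact: smooth_cst].
Qed.

Lemma Stilde_Zset z : Stilde z -> Zset z.
Proof. by move=> [Tz z1]; split=> //; rewrite /= z1. Qed.

Lemma Stilde_closed : closed_in (@Zset R n) Stilde.
Proof.
exists [set z | z.2 = 1]; last first.
  by apply/seteqP; split=> [z Sz|z [[Tz _] z1]//]; split; [exact: Stilde_Zset|case: Sz].
have s2 : smooth_on setT (fun z : Zamb => z.2 - 1).
  apply: smoothB => //; last exact: smooth_cst.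
  by apply: smooth_snd => //; exact: smooth_id.
rewrite (_ : mkset _ = ~` [set z : Zamb | setT z /\ z.2 - 1 != 0]).
  by apply: open_closedC; exact: open_smooth_neq0.
apply/seteqP; split=> z /=; first by move=> ->; rewrite subrr eqxx => -[].
by move=> H; apply/eqP; rewrite -subr_eq0; apply/negPn/negP => z1; exact: H.
Qed.

Lemma Stilde_wide : wide_subgroupoid (@Zset R n) Etilde (@eL R n) (@eR R n)
  (@stilde R n) (@mtilde R n) Stilde.
Proof.
have gZ := @Z_groupoid_tilde R n n0.
have EP z : Etilde z -> Stilde z.
  by rewrite (EtildeE n0) => -[p Sp <-]; have [] := Zset_unit Sp.
split; last exact: EP.
split; first exact: Stilde_Zset.
  move=> z Sz; have Zz := Stilde_Zset Sz; split.
  - exact: EP (lproj_unit gZ Zz).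
  - exact: EP (rproj_unit gZ Zz).
  - have [TZ _] := inv_closed gZ Zz; split=> //.
    by rewrite (stildeE n0)//=; case: Sz => _ ->; rewrite invr1.
move=> z1 z2 S1 S2 E.
have c12 : composable Zset (@eL R n) (@eR R n) (z1, z2).
  by split=> //; exact: Stilde_Zset.
have [TZ _] := mul_closed gZ c12; split=> //.
by rewrite (mtildeE n0)//=; case: S1 S2 => _ -> [_ ->]; rewrite mulr1.
Qed.

Lemma graph_stilde_fun : graph_stilde = [set (stilde z, z) | z in @Zset R n].
Proof.
apply/seteqP; split=> [[z' z] /(graph_stildeE n0)[Zz ->]|_ [z Zz <-]].
  by exists z => //; rewrite stildeE.
by apply/(graph_stildeE n0); rewrite stildeE.
Qed.

Lemma graph_mtilde_fun : graph_mtilde = [set (mtilde z.1 z.2, z.1, z.2) |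
  z in composable (@Zset R n) (@eL R n) (@eR R n)].
Proof.
apply/seteqP; split=> [[[z z1] z2] /(graph_mtildeE n0)[c12 ->]|_ [[z1 z2] c12 <-]].
  by exists (z1, z2); rewrite /= ?(mtildeE n0)//; exact/composable_eLR.
by apply/(graph_mtildeE n0); split; [exact/composable_eLR|exact: mtildeE].
Qed.

End SpecialSubgroupoids.

Theorem proposition4p1 (R : realType) (n : nat) (hn : (2 <= n)%N) :
  (* Z = G / B_0 is identified with TS^n x R_+ by piZ *)
  (@piZ R n @` G = Zset /\
   (forall g g' : 'M[R]_(1 + (n + 1)), G g -> G g' ->
     (piZ g = piZ g' <-> exists2 b0, B0 b0 & g' = g *m b0)))
  (* the quotient relations form a differential groupoid *)
  /\ (graph_stilde = [set (stilde z, z) | z in @Zset R n] /\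
      graph_mtilde = [set (mtilde z.1 z.2, z.1, z.2) |
                        z in composable (@Zset R n) (@eL R n) (@eR R n)] /\
      differential_groupoid (n + n).+1 n (@Zset R n) Etilde
        (@eL R n) (@eR R n) (@stilde R n) (@mtilde R n))
  (* (a) *)
  /\ @Etilde R n = [set (p, 0, 1) | p in sphere]
  (* (b) *)
  /\ ([set z : Zamb R n | Zset z /\ eL z = (p0, 0, 1)] = F0 /\
      [set z : Zamb R n | Zset z /\ eR z = (p0, 0, 1)] = F0 /\
      @Zset R n = F0 `|` Z1 /\
      @F0 R n `&` Z1 = set0 /\
      is_group (@F0 R n) (p0, 0, 1) (@stilde R n) (@mtilde R n) /\
      open_in (@Zset R n) Z1 /\
      subgroupoid (@Zset R n) (@eL R n) (@eR R n) (@stilde R n)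
        (@mtilde R n) Z1 /\
      @Zset R n = Zset `&` closure Z1)
  (* (c) *)
  /\ (@F0 R n = [set z | exists s mu, 0 < s /\ z = F0coord s mu] /\
      (forall (s1 s2 : R) (mu1 mu2 : 'cV[R]_n), 0 < s1 -> 0 < s2 ->
        mtilde (F0coord s1 mu1) (F0coord s2 mu2)
          = F0coord (s1 * s2) (s2 *: mu1 + mu2)) /\
      (forall (s : R) (mu : 'cV[R]_n), 0 < s ->
        stilde (F0coord s mu) = F0coord s^-1 (- (s^-1 *: mu))) /\
      exists phi : Zamb R n -> 'M[R]_(1 + (n + 1)),
        [/\ diffeo F0 C phi,
            forall z1 z2, F0 z1 -> F0 z2 ->
              phi (mtilde z1 z2) = phi z1 *m phi z2 &
            forall (s : R) (mu : 'cV[R]_n), 0 < s ->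
              phi (F0coord s mu) = Cmx s mu])
  (* (d) *)
  /\ (cancel (@stereo_inv R n) (@stereo R n) /\
      diffeo [set q : 'cV[R]_n * 'cV[R]_n * R | 0 < q.2] Z1
        (fun q => kappa q.1.1 q.1.2 q.2) /\
      (forall (x xd : 'cV[R]_n) (s : R), 0 < s ->
        stilde (kappa x xd s) =
          kappa (s *: x - (2 / (1 + dot x x)) *: xd)
            (- (((1 + dot (s *: x - (2 / (1 + dot x x)) *: xd)
                          (s *: x - (2 / (1 + dot x x)) *: xd))
                 / (1 + dot x x)) *: (s^-1 *: xd)))
            s^-1) /\
      [set t | [/\ @graph_mtilde R n t, Z1 t.1.1, Z1 t.1.2 & Z1 t.2]] =
        [set t | exists (x1 xd1 : 'cV[R]_n) (s1 : R) (x2 xd2 : 'cV[R]_n)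
                        (s2 : R),
          [/\ 0 < s1, 0 < s2,
              x2 = s1 *: x1 - (2 / (1 + dot x1 x1)) *: xd1 &
              t = (kappa x1
                     (s2 *: xd1 + ((1 + dot x1 x1) / (1 + dot x2 x2)) *: xd2)
                     (s1 * s2),
                   kappa x1 xd1 s1, kappa x2 xd2 s2)]] /\
      (forall (x xd : 'cV[R]_n) (s : R), 0 < s ->
        eL (kappa x xd s) = kappa x 0 1 /\
        eR (kappa x xd s) =
          kappa (s *: x - (2 / (1 + dot x x)) *: xd) 0 1))
  (* (e) *)
  /\ (transitive_groupoid (@Z1 R n) (Etilde `&` Z1) (@eL R n) (@eR R n) /\
      (forall x0 : 'cV[R]_n,
        isotropy Z1 (@eL R n) (@eR R n) (kappa x0 0 1) =
          [set kappa x0 (((s - 1) * (1 + dot x0 x0) / 2) *: x0) s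
            | s in [set s : R | 0 < s]]))
  (* (f) *)
  /\ (closed_in (@Zset R n) Stilde /\
      submanifold (n + n) (@Stilde R n) /\
      wide_subgroupoid (@Zset R n) Etilde (@eL R n) (@eR R n)
        (@stilde R n) (@mtilde R n) Stilde).

Proof.
have n0 : (0 < n)%N by exact: ltnW.
split; first by split; [exact: piZ_image|exact: piZ_fibers].
split.
  split; first exact: graph_stilde_fun.
  by split; [exact: graph_mtilde_fun|exact: Z_differential].
split; first exact: EtildeE.
split.
  split; first exact: eL_fiber_p0.
  split; first exact: eR_fiber_p0.
  split; first exact: Zset_F0_Z1.
  split; first by apply/seteqP; split=> // z [[zp _ _] [_ /(_ zp)]].
  split; first exact: F0_group.
  split; first exact: Z1_open.
  by split; [exact: Z1_subgroupoid|exact: Z1_dense].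
split.
  split; first by apply/seteqP; split=> z /F0P.
  split; first by move=> s1 s2 mu1 mu2; exact: mtilde_F0.
  by split; [move=> s mu; exact: stilde_F0|exact: F0_diffeo_C].
split.
  split; first exact: stereo_invK.
  split; first exact: kappa_diffeo.
  split; first by move=> x xd s; exact: stilde_kappa.
  split; first exact: graph_mtilde_kappa.
  by move=> x xd s s0; split; [exact: eL_kappa|exact: eR_kappa].
split; first by split; [exact: Z1_transitive|exact: Z1_isotropy].
split; first exact: Stilde_closed.
by split; [exact: submanifold_Stilde|exact: Stilde_wide].
Qed.
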